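(* Let $\mathcal{K}$ be a finite field, let $\mathbb{F}_r$ be the free group on $r$ generators, and let $\{\theta_k:\mathbb{F}_r\to \mathrm{Mat}_{n_k\times n_k}(\mathcal{K})\}_{k=1}^\infty$ be a convergent sequence of linear representations satisfying the Atiyah condition. Let $\theta:\mathbb{F}_r\to D$ be the unique generating limit representation of $\{\theta_k\}_{k=1}^\infty$ into a skew field $D$ over $\mathcal{K}$ (unique up to isomorphism of skew fields compatible with the homomorphisms from $\mathbb{F}_r$). Then $\{\theta_k\}_{k=1}^\infty$ is hyperfinite if and only if $D$ is an amenable skew field.
   Context: A linear representation $\theta_k:\mathbb{F}_r\to \mathrm{Mat}_{n_k\times n_k}(\mathcal{K})$ is a homomorphism of $\mathbb{F}_r$ into the group of invertible $n_k\times n_k$ matrices over $\mathcal{K}$. It is extended linearly to the group algebra $\mathcal{K}\mathbb{F}_r$ and entrywise to matrices, so that for $A\in\mathrm{Mat}_{n\times n}(\mathcal{K}\mathbb{F}_r)$ we have $\theta_k(A)\in \mathrm{Mat}_{n_kn\times n_kn}(\mathcal{K})$. Put $\mathrm{rk}^n_{n_k}(\theta_k(A))=\mathrm{Rank}(\theta_k(A))/n_k$. The sequence is convergent if $\lim_{k\to\infty}\mathrm{rk}^n_{n_k}(\theta_k(A))$ exists for all $n\ge1$ and $A\in \mathrm{Mat}_{n\times n}(\mathcal{K}\mathbb{F}_r)$. It satisfies the Atiyah condition if all these limits are integers. A homomorphism $\theta:\mathbb{F}_r\to D$ into the multiplicative group of a skew field $D$ over $\mathcal{K}$ (extended linearly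 to $\mathcal{K}\mathbb{F}_r$ and entrywise to matrices) is a limit of $\{\theta_k\}$ if $\lim_{k\to\infty}\mathrm{rk}^n_{n_k}(\theta_k(A))=\mathrm{rk}^n_D(\theta(A))$ for all $n\ge1$ and $A\in\mathrm{Mat}_{n\times n}(\mathcal{K}\mathbb{F}_r)$, where $\mathrm{rk}^n_D$ is the usual rank of $n\times n$ matrices over $D$ (with values in $\{0,\dots,n\}$). It is generating if the image of $\mathcal{K}\mathbb{F}_r$ generates $D$ as a skew field. Under the Atiyah condition a generating limit into a skew field exists and is unique up to isomorphism commuting with the maps from $\mathbb{F}_r$. Let $\gamma_1,\dots,\gamma_r$ be the standard generators of $\mathbb{F}_r$. The sequence $\{\theta_k\}$ is hyperfinite if for any $\epsilon>0$ there exists $K_\epsilon>0$ such that for all $k\ge1$ there are $\mathcal{K}$-linear subspaces $V^k_1,\dots,V^k_{t_k}\subset\mathcal{K}^{n_k}$ such that: (i) $\dim_{\mathcal{K}}(V^k_j)\le K_\epsilon$ for $1\le j\le t_k$; (ii) the subspaces $V^k_j+\sum_{i=1}^r\theta_k(\gamma_i)V^k_j$, $1\le j\le t_k$, are independent (their sum is direct) and $\dim_{\mathcal{K}}(V^k_j+\sum_{i=1}^r\theta_k(\gamma_i)V^k_j)<(1+\epsilon)\dim_{\mathcal{K}}(V^k_j)$ for each $j$; (iii) $\sum_{j=1}^{t_k}\dim_{\mathcal{K}}(V^k_j)\ge(1-\epsilon)n_k$. A skew field $D$ of countable dimension over $\mathcal{K}$ is amenable if for any $\epsilon>0$ and any finite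 dimensional $\mathcal{K}$-subspace $E\subset D$ with $1\in E$ there exists a finite dimensional $\mathcal{K}$-subspace $V\subset D$ such that $\dim_{\mathcal{K}} EV<(1+\epsilon)\dim_{\mathcal{K}}V$, where $EV$ is the linear span of the products $ev$, $e\in E$, $v\in V$. *)

(* Defs.v *)
From HB Require Import structures.
From mathcomp Require Import all_boot all_order all_algebra finmap.
From mathcomp Require Import all_classical all_reals all_analysis.
Set Implicit Arguments.
Unset Strict Implicit.
Unset Printing Implicit Defensive.
Import Order.TTheory GRing.Theory Num.Theory numFieldNormedType.Exports.
Local Open Scope classical_set_scope.
Local Open Scope ring_scope.

(* The free group is built as the group of reduced words; the letter
   [(i, false)] is the [i]-th generator and [(i, true)] is its inverse. *)

Section FreeGroup.
Variable r : nat.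
Implicit Types (x y : 'I_r * bool) (u v w : seq ('I_r * bool)).

Definition inv_letter x := (x.1, ~~ x.2).

Definition reduced w := sorted (fun x y => y != inv_letter x) w.

(* [cons_letter x w] is the reduced form of [x :: w] when [w] is reduced. *)
Definition cons_letter x w :=
  if w is y :: w' then if y == inv_letter x then w' else x :: w else [:: x].

Definition mul_word u v := foldr cons_letter v u.

Definition inv_word w := rev (map inv_letter w).

Record free_group := FreeGroup {
  fg_word :> seq ('I_r * bool);
  fg_reduced : reduced fg_word
}.

HB.instance Definition _ := [isSub for fg_word].
HB.instance Definition _ := [Choice of free_group by <:].

Lemma inv_letterK : involutive inv_letter.
Proof. by case=> i b; rewrite /inv_letter /= negbK. Qed.

Lemma reduced_behead x w : reduced (x :: w) -> reduced w.
Proof. exact: path_sorted. Qed.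

Lemma cons_letter_reduced x w : reduced w -> reduced (cons_letter x w).
Proof.
case: w => [|y w] //= red_w; case: eqP => [_|/eqP neq].
  exact: (path_sorted red_w).
by rewrite /reduced /= neq.
Qed.

Lemma mul_word_reduced u v : reduced v -> reduced (mul_word u v).
Proof. by move=> red_v; elim: u => //= x u; apply: cons_letter_reduced. Qed.

Lemma cons_letterE x w : reduced (x :: w) -> cons_letter x w = x :: w.
Proof. by case: w => [|y w] //= /andP[/negbTE ->]. Qed.

Lemma cons_letterK x w :
  reduced w -> cons_letter (inv_letter x) (cons_letter x w) = w.
Proof.
case: w => [|y w] /= red_w; first by rewrite inv_letterK eqxx.
case: eqP => [yE|_]; last by rewrite /= inv_letterK eqxx.
by rewrite -yE; apply: cons_letterE.
Qed.

Lemma cons_letterVK x w :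
  reduced w -> cons_letter x (cons_letter (inv_letter x) w) = w.
Proof. by move=> /(cons_letterK (inv_letter x)); rewrite inv_letterK. Qed.

Lemma mul_word_cons x u v :
  reduced v -> mul_word (cons_letter x u) v = cons_letter x (mul_word u v).
Proof.
move=> red_v; case: u => [|y u] //=; case: eqP => [->|//].
by rewrite cons_letterVK //; apply: mul_word_reduced.
Qed.

Lemma mul_wordA u v w :
  reduced w -> mul_word u (mul_word v w) = mul_word (mul_word u v) w.
Proof. by move=> red_w; elim: u => //= x u ->; rewrite mul_word_cons. Qed.

Lemma mul_word1 w : reduced w -> mul_word w [::] = w.
Proof.
elim: w => //= x w IHw red_xw.
by rewrite IHw ?(reduced_behead red_xw) // cons_letterE.
Qed.

Lemma inv_word_cons x w : inv_word (x :: w) = rcons (inv_word w) (inv_letter x).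
Proof. by rewrite /inv_word /= rev_cons. Qed.

Lemma inv_word_reduced w : reduced w -> reduced (inv_word w).
Proof.
rewrite /reduced /inv_word rev_sorted sorted_map; apply: sub_sorted => x y /=.
by apply: contraNN => /eqP/(can_inj inv_letterK) ->; rewrite inv_letterK.
Qed.

Lemma inv_wordK : involutive inv_word.
Proof.
by move=> w; rewrite /inv_word map_rev revK mapK //; apply: inv_letterK.
Qed.

Lemma mul_inv_word w : reduced w -> mul_word (inv_word w) w = [::].
Proof.
elim: w => //= x w IHw red_xw.
have red_w := reduced_behead red_xw.
rewrite inv_word_cons /mul_word foldr_rcons -(cons_letterE red_xw).
by rewrite cons_letterK //; apply: IHw.
Qed.

Definition fg_one := @FreeGroup [::] isT.
Definition fg_mul (g h : free_group) : free_group :=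
  FreeGroup (@mul_word_reduced g h (fg_reduced h)).
Definition fg_inv (g : free_group) : free_group :=
  FreeGroup (inv_word_reduced (fg_reduced g)).

Lemma fg_mulA : associative fg_mul.
Proof. by move=> g h k; apply/val_inj/mul_wordA/fg_reduced. Qed.
Lemma fg_mul1 : left_id fg_one fg_mul.
Proof. by move=> g; apply/val_inj. Qed.
Lemma fg_mulr1 : right_id fg_one fg_mul.
Proof. by move=> g; apply/val_inj/mul_word1/fg_reduced. Qed.
Lemma fg_mulV : left_inverse fg_one fg_inv fg_mul.
Proof. by move=> g; apply/val_inj/mul_inv_word/fg_reduced. Qed.
Lemma fg_mulVr : right_inverse fg_one fg_inv fg_mul.
Proof.
move=> g; apply/val_inj; rewrite /= -{1}(inv_wordK g).
exact/mul_inv_word/inv_word_reduced/fg_reduced.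
Qed.

HB.instance Definition _ :=
  isGroup.Build free_group fg_mulA fg_mul1 fg_mulr1 fg_mulV fg_mulVr.

Definition fg_gen (i : 'I_r) : free_group := @FreeGroup [:: (i, false)] isT.

End FreeGroup.

(* Finitely supported functions on the group. Only the linear structure of the
   group algebra is needed to extend maps linearly, so its product is not
   defined. *)
Notation group_algebra K G := {fsfun G -> K with 0}.

Definition lin_ext (K : nzRingType) (G : choiceType) (V : lmodType K)
    (f : G -> V) (a : group_algebra K G) : V :=
  \sum_(g <- finsupp a) a g *: f g.

Definition is_linear_repr (K : fieldType) (G : groupType) (m : nat)
    (f : G -> 'M[K]_m) : Prop :=
  [/\ forall g, f g \in unitmx,
      f 1%g = 1%:M
    & forall g h, f (g * h)%g = f g *m f h].

Definition is_unit_hom (D : unitRingType) (G : groupType) (f : G -> D) : Prop :=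
  [/\ forall g, f g \is a GRing.unit,
      f 1%g = 1
    & forall g h, f (g * h)%g = f g * f h].

Definition repr_mx (K : fieldType) (G : choiceType) (m n : nat)
    (f : G -> 'M[K]_m) (A : 'M[group_algebra K G]_n) :
    'M[K]_(\sum_(i < n) m) :=
  \mxblock_(i < n, j < n) lin_ext f (A i j).

Definition normalized_rank (R : realType) (K : fieldType) (G : choiceType)
    (m n : nat) (f : G -> 'M[K]_m) (A : 'M[group_algebra K G]_n) : R :=
  (\rank (repr_mx f A))%:R / m%:R.

Definition is_skew_field (D : unitRingType) : Prop :=
  forall x : D, x != 0 -> x \is a GRing.unit.

Definition left_free_rows (D : nzRingType) (n : nat) (A : 'M[D]_n)
    (S : {set 'I_n}) : Prop :=
  forall c : 'I_n -> D,
    \sum_(i in S) c i *: row i A = 0 -> forall i, i \in S -> c i = 0.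

(* Over a skew field this is the dimension of the left row space (equivalently,
   of the right column space). *)
Definition skew_rank (D : nzRingType) (n : nat) (A : 'M[D]_n) : nat :=
  \max_(S : {set 'I_n} | `[< left_free_rows A S >]) #|S|.

Section Sequences.
Variables (R : realType) (K : fieldType) (r : nat) (n : nat -> nat).
Variable theta_ : forall k, free_group r -> 'M[K]_(n k).

Definition convergent : Prop :=
  forall (m : nat) (A : 'M[group_algebra K (free_group r)]_m), (0 < m)%N ->
    exists l : R, normalized_rank R (theta_ k) A @[k --> \oo] --> l.

Definition Atiyah_condition : Prop :=
  forall (m : nat) (A : 'M[group_algebra K (free_group r)]_m), (0 < m)%N ->
    forall l : R, normalized_rank R (theta_ k) A @[k --> \oo] --> l ->
      l \is a Num.int.

Definition is_limit (D : unitAlgType K) (theta : free_group r -> D) : Prop :=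
  forall (m : nat) (A : 'M[group_algebra K (free_group r)]_m), (0 < m)%N ->
    normalized_rank R (theta_ k) A @[k --> \oo] -->
      ((skew_rank (map_mx (lin_ext theta) A))%:R : R).

(* [directv] analyses the syntax of its argument up to unfolding definitions;
   stating it for a variable family prevents it from also requiring that each
   [W j] be a direct sum when it is instantiated below. *)
Definition independent_subspaces (L : vectType K) (t : nat)
    (W : 'I_t -> {vspace L}) : bool :=
  directv (\sum_(j < t) W j)%VS.

Definition repr_boundary (k : nat) (V : {vspace 'cV[K]_(n k)}) :
    {vspace 'cV[K]_(n k)} :=
  (V + \sum_(i < r) (linfun (mulmx (theta_ k (fg_gen i))) @: V))%VS.

Definition hyperfinite : Prop :=
  forall eps : R, 0 < eps -> exists2 Keps : R, 0 < Keps &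
    forall k : nat, exists (t : nat) (V : 'I_t -> {vspace 'cV[K]_(n k)}),
      [/\ forall j, (\dim (V j))%:R <= Keps,
          independent_subspaces (fun j => repr_boundary (V j)),
          forall j, (\dim (repr_boundary (V j)))%:R <
                      (1 + eps) * (\dim (V j))%:R
        & (1 - eps) * (n k)%:R <= \sum_(j < t) (\dim (V j))%:R].

End Sequences.

(* The only division subring containing the image of the group algebra is
   the whole of [D]. *)
Definition is_generating (K : fieldType) (G : choiceType) (D : unitAlgType K)
    (theta : G -> D) : Prop :=
  forall S : {pred D}, GRing.divring_closed S ->
    (forall a : group_algebra K G, lin_ext theta a \in S) ->
    forall x : D, x \in S.

Section Amenable.
Variables (R : realType) (K : fieldType) (D : unitAlgType K).

Definition lin_span (S : set D) : set D :=
  [set x | exists (t : nat) (c : 'I_t -> K) (s : 'I_t -> D),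
    (forall i, S (s i)) /\ x = \sum_(i < t) c i *: s i].

Definition has_dim (V : set D) (d : nat) : Prop :=
  exists b : 'I_d -> D,
    (forall c : 'I_d -> K, \sum_(i < d) c i *: b i = 0 -> forall i, c i = 0) /\
    V = lin_span (range b).

Definition countable_dim : Prop :=
  exists e : nat -> D, lin_span (range e) = setT.

Definition prod_span (E V : set D) : set D :=
  lin_span [set x | exists e v, [/\ E e, V v & x = e * v]].

Definition amenable : Prop :=
  countable_dim /\
  forall (eps : R) (E : set D) (e : nat), 0 < eps -> has_dim E e -> E 1 ->
    exists (V : set D) (d dEV : nat),
      [/\ has_dim V d, has_dim (prod_span E V) dEV
        & dEV%:R < (1 + eps) * d%:R].

End Amenable.

(* Main.v *)
Require Import Defs.
From HB Require Import structures.
From mathcomp Require Import all_boot all_order all_algebra finmap mxabelem.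
From mathcomp Require Import all_classical all_reals all_analysis.
From mathcomp Require Import zify ring lra.
Set Implicit Arguments.
Unset Strict Implicit.
Unset Printing Implicit Defensive.
Import Order.TTheory GRing.Theory Num.Theory numFieldNormedType.Exports.
Local Open Scope classical_set_scope.
Local Open Scope ring_scope.

(** Almost invariant subspaces are encoded by finite data. Given matrices [H]
    and [T i] over [K], a model in a module over the free group is a tuple [y]
    of vectors with [gamma_i (H y) = T i y] for every generator: the generators
    map the span of [H y] into the span of [y]. If [H] has [s] independent rows
    and [y] has [m < (1 + eps) s] independent entries, the span of [H y] is an
    almost invariant subspace, and each such subspace arises in this way
    ([model_of_subspace], [free_model_of_amenable]).

    Models are the solutions of a linear system over the group algebra, and so
    are the models [y] with [t y = 0], for a row [t] over [K]. By rank-nullity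
    the difference of the ranks of the two systems is the dimension of the space
    of values [t y] on the models [y], over [K] in a representation
    ([model_values]) and over [D] in [D]. The latter space is a right subspace
    of [D], so it is [0] or [D] ([model_skew_rank_le], [model_skew_rank_gt]).
    Passing to the limit, the values of [t] on the models in [K ^ n_k] span
    either [o(n_k)] or [(1 - o(1)) n_k] dimensions, according to whether [t]
    vanishes on all models in [D] ([rank_increment]).

    Hyperfinite implies amenable. As [K] is finite, bounded sizes allow finitely
    many data, so some data occur at least [c n_k] times among the independent
    subspaces of a suitable representation. No [t != 0] then vanishes on all
    models in [D] ([rare_models]). Since models may be multiplied by elements of
    [D] on the right and the [t] are finite in number, an infinite [D] has a
    model on which no [t != 0] vanishes ([generic_model]), that is, a subspace
    almost invariant under the generators ([stable_of_hyperfinite]). Almost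
    invariance passes to differences, products and inverses, so the elements for
    which the defect is linear in that of the generators form a division subring;
    it is all of [D] ([almost_stable_linear]), and [D] is amenable
    ([amenable_of_almost_stable]). If [D] is finite, [D] itself is the invariant
    subspace.

    Amenable implies hyperfinite. An almost invariant subspace of [D] is a model
    on which no [t != 0] vanishes, so every [t != 0] takes values of dimension
    about [n_k] on the models in [K ^ n_k]. Given models already chosen, whose
    entries span [W], the models [y] with [t y] in [W] form a subspace of large
    codimension as long as [W] leaves room; the finitely many [t] do not exhaust
    all models ([avoid_subspace]), and a model independent of the chosen ones can
    be added. The greedy choice ([packing]) ends with almost all of [K ^ n_k]
    covered. The representations of bounded dimension are treated by taking the
    whole space ([hyperfinite_full]). *)

(** * Ranks over a skew field *)

Section SkewRank.
Variables (D : unitRingType) (D_skew : is_skew_field D).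

(** Right-linear duality: a row that vanishes on the common kernel of the rows
    of [B] is a left combination of them. Gaussian elimination, one row at a
    time: either the first row already vanishes on the kernel of the others, or
    some [y0] in that kernel pairs to 1 with it and corrects [l]. *)
Lemma row_span_of_kernel N p (B : 'M[D]_(p, N)) (l : 'rV[D]_N) :
  (forall x : 'cV_N, B *m x = 0 -> l *m x = 0) -> exists c : 'rV_p, l = c *m B.
Proof.
elim: p B l => [|p IHp] B l kerB.
  exists 0; rewrite mul0mx -[l]mulmx1; apply/trmx_inj/row_matrixP => i.
  rewrite trmx0 row0 -tr_col colE -mulmxA kerB ?trmx0 //.
  by rewrite [B]flatmx0 mul0mx.
have [b [B' defB]] : exists (b : 'rV[D]_N) (B' : 'M[D]_(p, N)), col_mx b B' = B.
  by exists (@usubmx _ 1 p N B), (@dsubmx _ 1 p N B); apply: vsubmxK.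
have kerE (x : 'cV_N) : b *m x = 0 -> B' *m x = 0 -> l *m x = 0.
  move=> bx B'x; apply: kerB; rewrite -defB.
  by apply: etrans (mul_col_mx b B' x) _; rewrite bx B'x col_mx0.
have [bker|] := pselect (forall x : 'cV_N, B' *m x = 0 -> b *m x = 0).
  have [|c ->] := IHp B' l; first by move=> x B'x; apply: kerE => //; apply: bker.
  exists (row_mx 0 c : 'rV_(1 + p)); rewrite -defB; apply/esym.
  by apply: etrans (mul_row_col 0 c b B') _; rewrite mul0mx add0r.
move=> /existsNP[x0 /not_implyP[B'x0 /eqP bx0]].
pose a := (b *m x0) 0 0.
have a_unit : a \is a GRing.unit.
  apply: D_skew; apply: contra bx0 => /eqP a0.
  by rewrite [X in X == _]mx11_scalar -/a a0 raddf0.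
have [y0 by0 B'y0] : exists2 y0 : 'cV_N, b *m y0 = 1%:M & B' *m y0 = 0.
  exists (x0 *m (a^-1)%:M); last by rewrite mulmxA B'x0 mul0mx.
  by rewrite mulmxA (mx11_scalar (b *m x0)) -/a -scalar_mxM mulrV.
have [|c defc] := IHp B' (l - (l *m y0) *m b).
  move=> x B'x; rewrite mulmxBl -!mulmxA -mulmxBr; apply: kerE.
    by rewrite mulmxBr mulmxA by0 mul1mx subrr.
  by rewrite mulmxBr B'x mulmxA B'y0 mul0mx subrr.
exists (row_mx (l *m y0) c : 'rV_(1 + p)).
rewrite -defB; apply/esym; apply: etrans (mul_row_col _ c b B') _.
by rewrite -defc addrC subrK.
Qed.

Section AddRow.
Variables (N : nat) (B B' : 'M[D]_N) (i0 : 'I_N).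
Hypothesis rowB' : forall i, i != i0 -> row i B' = row i B.
Hypothesis rowB0 : row i0 B = 0.

Lemma left_free_rowsS (A : 'M[D]_N) (S T : {set 'I_N}) :
  S \subset T -> left_free_rows A T -> left_free_rows A S.
Proof.
move=> /fintype.subsetP sST freeT c; rewrite big_mkcond /= => sum0 i iS.
have := freeT (fun i => if i \in S then c i else 0); rewrite big_mkcond /=.
have -> : \sum_(i0 < N) (if i0 \in T then (if i0 \in S then c i0 else 0)
    *: row i0 A else 0) = 0.
  rewrite -[RHS]sum0; apply: eq_bigr => j _.
  by case: (boolP (j \in S)) => [/sST->//|_]; rewrite scale0r if_same.
by move=> /(_ erefl i (sST i iS)); rewrite iS.
Qed.

Lemma skew_rank_attained (A : 'M[D]_N) :
  exists2 S, left_free_rows A S & skew_rank A = #|S|.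
Proof.
rewrite /skew_rank.
have [|S /asboolP freeS ->] := @eq_bigmax_cond _
  [pred S : {set 'I_N} | `[< left_free_rows A S >]] (fun S => #|S|); last by exists S.
apply/card_gt0P; exists finset.set0; rewrite inE.
by move=> c _ i; rewrite inE.
Qed.

Lemma skew_rank_ge (A : 'M[D]_N) S : left_free_rows A S -> (#|S| <= skew_rank A)%N.
Proof.
by move=> freeS; apply: (@leq_bigmax_cond _ _ (fun S : {set 'I_N} => #|S|));
  apply/asboolP.
Qed.

Lemma eq_left_free_rows (S : {set 'I_N}) :
  i0 \notin S -> left_free_rows B S <-> left_free_rows B' S.
Proof.
move=> i0S; have eqS c :
    \sum_(i in S) c i *: row i B = \sum_(i in S) c i *: row i B'.
  by apply: eq_bigr => i iS; rewrite rowB' //; apply: contraNneq i0S => <-.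
by split=> freeS c; [rewrite -eqS | rewrite eqS] => /freeS.
Qed.

(** Pairing a relation with [x] isolates the coefficient of the added row. *)
Lemma skew_rank_add_row_gt :
  (exists2 x : 'cV_N, B *m x = 0 & row i0 B' *m x <> 0) ->
  (skew_rank B < skew_rank B')%N.
Proof.
move=> [x Bx lx]; have [S freeS ->] := skew_rank_attained B.
have i0S : i0 \notin S.
  apply/negP => i0S; have := freeS (fun i => (i == i0)%:R).
  rewrite big1 => [/(_ erefl _ i0S)/eqP|i _]; first by rewrite eqxx oner_eq0.
  by case: eqP => [->|_]; rewrite ?rowB0 ?scaler0 ?scale0r.
apply: leq_trans (skew_rank_ge (S := i0 |: S) _); first by rewrite cardsU1 i0S.
move=> c; rewrite big_setU1 //= => sum0.
have ci0 : c i0 = 0.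
  have := congr1 (mulmx^~ x) sum0; rewrite mul0mx mulmxDl mulmx_suml.
  rewrite big1 ?addr0 => [|i iS]; last first.
    rewrite rowB'; last by apply: contraNneq i0S => <-.
    by rewrite -scalemxAl -row_mul Bx row0 scaler0.
  rewrite -scalemxAl => clx; apply/eqP; apply: contrapT => /negP c0; apply: lx.
  by rewrite -[LHS]scale1r -(mulVr (D_skew c0)) -scalerA clx scaler0.
move: sum0; rewrite ci0 scale0r add0r => sum0 i /setU1P[->//|].
exact: (iffLR (eq_left_free_rows i0S) freeS c sum0 i).
Qed.

Lemma row_span_of_maximal (S : {set 'I_N}) (i : 'I_N) (A : 'M[D]_N) :
  left_free_rows A S -> i \notin S -> ~ left_free_rows A (i |: S) ->
  exists c : 'I_N -> D, row i A = \sum_(j in S) c j *: row j A.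
Proof.
move=> freeS iS /existsNP[c /not_implyP[]]; rewrite big_setU1 //= => sum0.
move=> /existsNP[j /not_implyP[jS /eqP cj]].
have ci : c i != 0.
  apply: contra cj => /eqP ci0; move: sum0; rewrite ci0 scale0r add0r => sum0.
  by case/setU1P: jS => [->|/(freeS _ sum0)->]; rewrite ?ci0.
exists (fun j => - ((c i)^-1 * c j)).
rewrite -[LHS]scale1r -(mulVr (D_skew ci)) -scalerA (canRL (addrK _) sum0).
rewrite sub0r scalerN scaler_sumr -sumrN.
by apply: eq_bigr => k _; rewrite scalerA scaleNr.
Qed.

(** The added row is by duality a combination of the others, so a free set that
    uses it can exchange it for one of them. *)
Lemma skew_rank_add_row_le :
  (forall x : 'cV_N, B *m x = 0 -> row i0 B' *m x = 0) ->
  (skew_rank B' <= skew_rank B)%N.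
Proof.
move=> kerl; have [S freeS ->] := skew_rank_attained B'.
have [i0S|i0S] := boolP (i0 \in S); last first.
  by apply: skew_rank_ge; apply/(eq_left_free_rows i0S).
pose S1 := S :\ i0.
have i0S1 : i0 \notin S1 by rewrite !inE eqxx.
have freeS1 : left_free_rows B S1.
  by apply/(eq_left_free_rows i0S1); apply: left_free_rowsS freeS; apply: subD1set.
have [[i iS1 freei]|nofree] := pselect
    (exists2 i, i \notin S1 & left_free_rows B (i |: S1)).
  by apply: leq_trans (skew_rank_ge freei); rewrite cardsU1 iS1 (cardsD1 i0) i0S.
(* otherwise [S1] spans all rows of [B], hence row [i0] of [B'] as well,
   against the freeness of [S] *)
have spanB i : exists c : 'I_N -> D, row i B = \sum_(j in S1) c j *: row j B.
  have [iS1|iS1] := boolP (i \in S1).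
    exists (fun j => (j == i)%:R); rewrite (bigD1 i) //= eqxx scale1r big1 ?addr0 //.
    by move=> j /andP[_ /negPf->]; rewrite scale0r.
  by apply: row_span_of_maximal => // freei; apply: nofree; exists i.
have [c defc] := row_span_of_kernel kerl.
pose e i := sval (cid (spanB i)).
have defe i : row i B = \sum_(j in S1) e i j *: row j B by rewrite /e; case: cid.
have [f defl] : exists f : 'I_N -> D, row i0 B' = \sum_(j in S1) f j *: row j B.
  exists (fun j => \sum_i c 0 i * e i j); rewrite defc mulmx_sum_row.
  under eq_bigr => i _ do rewrite defe scaler_sumr.
  rewrite exchange_big /=; apply: eq_bigr => j _; rewrite scaler_suml.
  by apply: eq_bigr => i _; rewrite scalerA.
have := freeS (fun j => if j == i0 then -1 else f j).
rewrite (big_setD1 i0) //= eqxx scaleN1r defl.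
rewrite [X in _ + X](_ : _ = \sum_(j in S1) f j *: row j B); last first.
  apply: eq_bigr => j; rewrite in_setD1 => /andP[ji0 _].
  by rewrite (negPf ji0) rowB'.
by rewrite addNr => /(_ erefl i0 i0S)/eqP; rewrite eqxx oppr_eq0 oner_eq0.
Qed.

End AddRow.
End SkewRank.

(** * Local models and the matrix of their equations *)

(** A formal sum; a group element may occur several times in [s], so no case
    distinction is needed when a generator is compared with the unit. *)
Definition galg (K : nzRingType) (G : choiceType) (s : seq (K * G)) :
    group_algebra K G :=
  [fsfun x in [fset x in map snd s]%fset => \sum_(p <- s | p.2 == x) p.1 | 0].

Lemma lin_ext_galg (K : nzRingType) (G : choiceType) (V : lmodType K)
    (f : G -> V) (s : seq (K * G)) :
  lin_ext f (galg s) = \sum_(p <- s) p.1 *: f p.2.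
Proof.
pose A := [fset x in map snd s]%fset.
have galgE x : galg s x = \sum_(p <- s | p.2 == x) p.1.
  rewrite fsfunE; case: ifPn => //; rewrite !inE => xs.
  rewrite big_seq_cond big1 // => p /andP[ps /eqP px]; case/mapP: xs.
  by exists p.
have sA : (finsupp (galg s) `<=` A)%fset.
  by apply/fsubsetP => x; rewrite mem_finsupp fsfunE; case: ifPn; rewrite ?eqxx.
rewrite /lin_ext (big_fset_incl _ sA) => [|x _]; last first.
  by rewrite memNfinsupp => /eqP->; rewrite scale0r.
under eq_bigr => x _ do rewrite galgE scaler_suml big_mkcond.
rewrite exchange_big big_seq [RHS]big_seq /=; apply: eq_bigr => p ps.
have pA : p.2 \in A by rewrite !inE map_f.
rewrite (big_fsetD1 _ pA) /= eqxx big_seq big1 ?addr0 // => x.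
by rewrite !inE => /andP[xp _]; rewrite eq_sym (negPf xp).
Qed.

Section ModelSystem.
Variables (K : fieldType) (G : groupType) (r : nat) (gen : 'I_r -> G).
Variables (s m : nat) (H : 'M[K]_(s, m)) (T : 'I_r -> 'M[K]_(s, m)).

(** The vectors of a model are the rows of [Y], that is, transposed columns of
    [K ^ n], whence the transposed action on the right. *)
Definition repr_model n (f : G -> 'M[K]_n) (Y : 'M[K]_(m, n)) : Prop :=
  forall i, H *m Y *m (f (gen i))^T = T i *m Y.

Definition alg_model (D : unitAlgType K) (f : G -> D) (y : 'I_m -> D) : Prop :=
  forall i j, f (gen i) * (\sum_b H j b *: y b) = \sum_b T i j b *: y b.

(* The ranks to be compared are those of square matrices: rows and columns have
   the same index set, in which [inl] marks unknowns and [inr] equations, and the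
   matrix is zero outside the columns of unknowns and the rows of equations. The
   equation [None] is the additional one given by [t]. *)
Let Z : finType := ('I_m + option ('I_r * 'I_s))%type.

Definition model_coef (t : 'rV[K]_m) (z z' : Z) : seq (K * G) :=
  match z, z' with
  | inr (Some (i, j)), inl b => [:: (H j b, gen i); (- T i j b, 1%g)]
  | inr None, inl b => [:: (t 0 b, 1%g)]
  | _, _ => [::]
  end.

Definition model_mx t : 'M[group_algebra K G]_#|Z| :=
  \matrix_(i, j) galg (model_coef t (enum_val i) (enum_val j)).

Let i0 : 'I_#|Z| := enum_rank (inr None : Z).

Lemma sum_enum_sum (V : nmodType) (F : Z -> V) :
  (forall z, F (inr z) = 0) ->
  \sum_(i < #|Z|) F (enum_val i) = \sum_b F (inl b).
Proof.
move=> F0; rewrite -(big_enum_val (fun z => F z)) big_sumType /=.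
by rewrite [X in _ + X]big1 ?addr0.
Qed.

Lemma model_mxE t i j :
  model_mx t i j = galg (model_coef t (enum_val i) (enum_val j)).
Proof. by rewrite mxE. Qed.

Lemma model_mx_row (t t' : 'rV[K]_m) i j : i != i0 -> model_mx t i j = model_mx t' i j.
Proof.
rewrite !model_mxE => ii0; have : enum_val i != inr None.
  by apply: contra ii0 => /eqP eqi; rewrite /i0 -eqi enum_valK.
by case: (enum_val i) => [|[[]|]].
Qed.

Section Repr.
Variables (n : nat) (f : G -> 'M[K]_n) (f1 : f 1%g = 1%:M).

Let unknowns (z : 'rV[K]_(\sum_(i < #|Z|) n)) : 'M[K]_(m, n) :=
  \matrix_(b, j) submxrow z (enum_rank (inl b : Z)) 0 j.

Let row_unknowns z b : row b (unknowns z) = submxrow z (enum_rank (inl b : Z)).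
Proof. by apply/rowP => j; rewrite 2!mxE. Qed.

Let P t := (repr_mx f (model_mx t))^T.

Let submxrow_P z t i :
  submxrow (z *m P t) i =
  \sum_b row b (unknowns z) *m
    (lin_ext f (galg (model_coef t (enum_val i) (inl b))))^T.
Proof.
rewrite /P /repr_mx tr_mxblock -{1}(submxrowK z) mul_mxrow_mxblock mxrowK.
pose F (w : Z) := submxrow z (enum_rank w) *m
  (lin_ext f (galg (model_coef t (enum_val i) w)))^T.
rewrite (eq_bigr (fun j => F (enum_val j))); last first.
  by move=> j _; rewrite /F enum_valK model_mxE.
rewrite sum_enum_sum /F => [|w]; last first.
  rewrite lin_ext_galg; case: (enum_val i) => [?|[[? ?]|]] /=;
  by rewrite big_nil trmx0 mulmx0.
by apply: eq_bigr => b _; rewrite row_unknowns.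
Qed.

Let P_None z t : submxrow (z *m P t) i0 = t *m unknowns z.
Proof.
rewrite submxrow_P /i0 enum_rankK mulmx_sum_row; apply: eq_bigr => b _.
by rewrite lin_ext_galg big_seq1 /= f1 linearZ /= trmx1 -scalemxAr mulmx1.
Qed.

Let P_Some z t i j :
  submxrow (z *m P t) (enum_rank (inr (Some (i, j)) : Z)) =
  row j (H *m unknowns z *m (f (gen i))^T - T i *m unknowns z).
Proof.
rewrite submxrow_P enum_rankK linearB /= !row_mul.
rewrite (mulmx_sum_row (row j H)) (mulmx_sum_row (row j (T i))) mulmx_suml.
rewrite -sumrB; apply: eq_bigr => b _.
rewrite lin_ext_galg big_cons big_seq1 /= f1 linearD !linearZ /= trmx1 mulmxDr.
by rewrite -!scalemxAr mulmx1 scaleNr scalerN !mxE -scalemxAl.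
Qed.

Let P_inl z t b : submxrow (z *m P t) (enum_rank (inl b : Z)) = 0 :> 'rV[K]_n.
Proof.
rewrite submxrow_P enum_rankK big1 // => c _.
by rewrite lin_ext_galg big_nil trmx0 mulmx0.
Qed.

Let P_eq0 z t :
  z *m P t = 0 <-> repr_model f (unknowns z) /\ t *m unknowns z = 0.
Proof.
split=> [zP|[mdl tz]].
  have blk i : submxrow (z *m P t) i = 0 :> 'rV[K]_n.
    by rewrite zP; apply/matrixP => a b; rewrite !mxE.
  split=> [i|]; last by rewrite -P_None blk.
  apply/eqP; rewrite -subr_eq0; apply/eqP/row_matrixP => j.
  by rewrite -(P_Some _ t) blk row0.
apply/mxrowP => i; rewrite -(enum_valK i).
have -> : submxrow (0 : 'rV[K]_(\sum_(i < #|Z|) n)) (enum_rank (enum_val i)) = 0.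
  by apply/matrixP => a b; rewrite !mxE.
case: (enum_val i) => [b|[[j k]|]]; first exact: P_inl.
  by rewrite P_Some mdl subrr row0.
by rewrite P_None.
Qed.

(** The rank gained by adding the row [t] to the equations of the models is the
    dimension of the space of values [t *m Y] on the models [Y], by rank-nullity
    on the kernel of the equations. *)
Lemma model_values (t : 'rV[K]_m) :
  exists U : 'M[K]_(\sum_(i < #|Z|) n, n),
    \rank (repr_mx f (model_mx t)) =
      (\rank (repr_mx f (model_mx 0)) + \rank U)%N /\
    forall u : 'rV_n,
      (u <= U)%MS <-> exists2 Y, repr_model f Y & t *m Y = u.
Proof.
pose J := submxrow (P t) i0.
have mulJ z : z *m J = t *m unknowns z by rewrite mul_submxrow P_None.
exists (kermx (P 0) *m J); split.
  have capE : (kermx (P 0) :&: kermx J :=: kermx (P t))%MS.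
    apply/eqmxP/andP; split; apply/rV_subP => z.
      rewrite sub_capmx => /andP[/sub_kermxP/P_eq0[mdl _] /sub_kermxP].
      by rewrite mulJ => tz; apply/sub_kermxP/P_eq0.
    move=> /sub_kermxP/P_eq0[mdl tz]; rewrite sub_capmx; apply/andP; split.
      by apply/sub_kermxP/P_eq0; rewrite mul0mx.
    by apply/sub_kermxP; rewrite mulJ.
  have := mxrank_mul_ker (kermx (P 0)) J; rewrite capE !mxrank_ker.
  rewrite -[\rank (repr_mx f (model_mx t))]mxrank_tr -/(P t).
  rewrite -[\rank (repr_mx f (model_mx 0))]mxrank_tr -/(P 0).
  have := rank_leq_row (P t); have := rank_leq_row (P 0).
  move: (\rank _) (\rank _) (\rank _) => a b c; move: (\sum_(i < _) _)%N => d.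
  by move=> ad bd e; lia.
move=> u; split=> [/submxP[w ->]|[Y mdl <-]].
  rewrite mulmxA mulJ; exists (unknowns (w *m kermx (P 0))) => //.
  have : w *m kermx (P 0) *m P 0 = 0 by rewrite -mulmxA mulmx_ker mulmx0.
  by case/P_eq0.
pose z : 'rV[K]_(\sum_(i < #|Z|) n) := \mxrow_(i < #|Z|)
  (if enum_val i is inl b then row b Y else 0).
have unkz : unknowns z = Y.
  by apply/row_matrixP => b; rewrite row_unknowns mxrowK enum_rankK.
have : (z <= kermx (P 0))%MS.
  by apply/sub_kermxP/P_eq0; rewrite unkz mul0mx.
by move=> /(submxMr J); rewrite mulJ unkz.
Qed.

End Repr.

Section Alg.
Variables (D : unitAlgType K) (D_skew : is_skew_field D).
Variables (f : G -> D) (f1 : f 1%g = 1).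

Let B t := map_mx (lin_ext f) (model_mx t).

Let unknowns (x : 'cV[D]_#|Z|) (b : 'I_m) : D := x (enum_rank (inl b : Z)) 0.

Let mulB x t i :
  (B t *m x) i 0 =
  \sum_b lin_ext f (galg (model_coef t (enum_val i) (inl b))) * unknowns x b.
Proof.
rewrite mxE; pose F (w : Z) :=
  lin_ext f (galg (model_coef t (enum_val i) w)) * x (enum_rank w) 0.
rewrite (eq_bigr (fun j => F (enum_val j))); last first.
  by move=> j _; rewrite /F enum_valK mxE model_mxE.
rewrite sum_enum_sum /F // => w.
rewrite lin_ext_galg; case: (enum_val i) => [?|[[? ?]|]] /=;
by rewrite big_nil mul0r.
Qed.

Let B_None x t : (B t *m x) i0 0 = \sum_b t 0 b *: unknowns x b.
Proof.
rewrite mulB /i0 enum_rankK; apply: eq_bigr => b _.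
by rewrite lin_ext_galg big_seq1 /= f1 -scalerAl mul1r.
Qed.

Let B_Some x t i j :
  (B t *m x) (enum_rank (inr (Some (i, j)) : Z)) 0 =
  f (gen i) * (\sum_b H j b *: unknowns x b) - \sum_b T i j b *: unknowns x b.
Proof.
rewrite mulB enum_rankK mulr_sumr -sumrB; apply: eq_bigr => b _.
rewrite lin_ext_galg big_cons big_seq1 /= f1 mulrDl scaleNr mulNr.
by rewrite -!scalerAl mul1r scalerAr.
Qed.

Let B_inl (x : 'cV[D]_#|Z|) t b : (B t *m x) (enum_rank (inl b : Z)) 0 = 0.
Proof.
rewrite mulB enum_rankK big1 // => c _.
by rewrite lin_ext_galg big_nil mul0r.
Qed.

Let B0_eq0 (x : 'cV[D]_#|Z|) : B 0 *m x = 0 <-> alg_model f (unknowns x).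
Proof.
split=> [Bx i j|mdl].
  by apply/eqP; rewrite -subr_eq0 -(B_Some _ 0) Bx mxE.
apply/colP => i; rewrite [RHS]mxE -(enum_valK i).
case: (enum_val i) => [b|[[j k]|]]; first exact: B_inl.
  by rewrite B_Some mdl subrr.
by rewrite B_None big1 // => b _; rewrite mxE scale0r.
Qed.

Let rowB t i : i != i0 -> row i (B t) = row i (B 0).
Proof. by move=> ii0; apply/rowP => j; rewrite !mxE -!model_mxE (model_mx_row t 0). Qed.

Let rowB0 : row i0 (B 0) = 0.
Proof.
apply/rowP => j; rewrite !mxE lin_ext_galg /i0 enum_rankK.
by case: (enum_val j) => [b|w]; rewrite ?big_nil // big_seq1 /= mxE scale0r.
Qed.

(** Replacing the zero row [None] of [B 0] by the row of [t] gives [B t], so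
    duality decides whether the rank grows. *)
Lemma model_skew_rank_le (t : 'rV[K]_m) :
  (forall y, alg_model f y -> \sum_b t 0 b *: y b = 0) ->
  (skew_rank (B t) <= skew_rank (B 0))%N.
Proof.
move=> kert; apply: (skew_rank_add_row_le D_skew (i0 := i0)) => [i|x Bx].
  exact: rowB.
rewrite -row_mul; apply/rowP => c; rewrite ord1 !mxE.
by have := B_None x t; rewrite mxE => ->; apply/kert/B0_eq0.
Qed.

Lemma model_skew_rank_gt (t : 'rV[K]_m) :
  (exists2 y, alg_model f y & \sum_b t 0 b *: y b != 0) ->
  (skew_rank (B 0) < skew_rank (B t))%N.
Proof.
move=> [y mdl ty]; apply: (skew_rank_add_row_gt D_skew (i0 := i0)) => [i|//|].
  exact: rowB.
pose x : 'cV[D]_#|Z| := \col_i (if enum_val i is inl b then y b else 0).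
have unkx : unknowns x = y.
  by apply/funext => b; rewrite /unknowns mxE enum_rankK.
exists x; first by apply/B0_eq0; rewrite unkx.
rewrite -row_mul => /rowP/(_ 0); rewrite mxE B_None unkx mxE => t0.
by rewrite t0 eqxx in ty.
Qed.

End Alg.
End ModelSystem.

(** * Finite-dimensional subspaces *)

Section FiniteDim.
Variables (K : fieldType) (D : unitAlgType K).

Definition free_family d (b : 'I_d -> D) : Prop :=
  forall c : 'I_d -> K, \sum_i c i *: b i = 0 -> forall i, c i = 0.

Lemma free_row_eq0 d (b : 'I_d -> D) (v : 'rV_d) :
  free_family b -> \sum_i v 0 i *: b i = 0 -> v = 0.
Proof. by move=> freeb /freeb v0; apply/rowP => i; rewrite v0 mxE. Qed.

Definition is_subspace (W : set D) : Prop :=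
  W 0 /\ forall c x y, W x -> W y -> W (c *: x + y).

Lemma subspace_sum (W : set D) (I : finType) (c : I -> K) (s : I -> D) :
  is_subspace W -> (forall i, W (s i)) -> W (\sum_i c i *: s i).
Proof.
move=> [W0 WD] Ws; elim/big_ind: _ => // [x y Wx Wy|i _].
  by rewrite -[x]scale1r; apply: WD.
by rewrite -[_ *: _]addr0; apply: WD.
Qed.

Lemma lin_span_min (S W : set D) : is_subspace W -> S `<=` W -> lin_span S `<=` W.
Proof.
by move=> subW SW _ [t [c [s [Ss ->]]]]; apply: subspace_sum => // i; apply: SW.
Qed.

Lemma sub_lin_span (S : set D) : S `<=` lin_span S.
Proof.
by move=> x Sx; exists 1%N, (fun=> 1), (fun=> x); rewrite big_ord1 scale1r.
Qed.

Lemma lin_span_subspace (S : set D) : is_subspace (lin_span S).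
Proof.
split=> [|a _ _ [t [c [s [Ss ->]]]] [t' [c' [s' [Ss' ->]]]]].
  by exists 0%N, (fun=> 0), (fun=> 0); rewrite big_ord0; split=> // -[].
exists (t + t')%N.
exists (fun i => match fintype.split i with inl j => a * c j | inr j => c' j end).
exists (fun i => match fintype.split i with inl j => s j | inr j => s' j end).
split=> [i|]; first by case: fintype.split.
rewrite big_split_ord scaler_sumr; congr (_ + _); apply: eq_bigr => i _.
  by rewrite (unsplitK (inl i)) scalerA.
by rewrite (unsplitK (inr i)).
Qed.

Lemma lin_span_range (I : finType) (y : I -> D) x :
  lin_span (range y) x <-> exists c : I -> K, x = \sum_i c i *: y i.
Proof.
split=> [spanx|[c ->]]; last first.
  apply: subspace_sum => [|i]; first exact: lin_span_subspace.
  by apply: sub_lin_span; exists i.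
suff: [set x | exists c : I -> K, x = \sum_i c i *: y i] x by [].
move: x spanx; apply: lin_span_min => [|_ [i _ <-]] /=.
  split=> [|a _ _ [c ->] [c' ->]].
    by exists (fun=> 0); rewrite big1 // => i _; rewrite scale0r.
  exists (fun i => a * c i + c' i); rewrite scaler_sumr -big_split /=.
  by apply: eq_bigr => i _; rewrite scalerDl scalerA.
exists (fun j => (j == i)%:R); rewrite (bigD1 i) //= eqxx scale1r big1 ?addr0 //.
by move=> j /negPf->; rewrite scale0r.
Qed.

Lemma free_family_bound (I : finType) (y : I -> D) d (b : 'I_d -> D) :
  free_family b -> (forall i, lin_span (range y) (b i)) -> (d <= #|I|)%N.
Proof.
move=> freeb spanb.
have /choice[c defb] i := (lin_span_range y (b i)).1 (spanb i).
pose M : 'M[K]_(d, #|I|) := \matrix_(i, j) c i (enum_val j).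
suff /eqP <- : row_free M by apply: rank_leq_col.
apply: inj_row_free => v vM; apply: (free_row_eq0 freeb).
under eq_bigr => j _ do rewrite defb scaler_sumr.
rewrite exchange_big /= big1 // => k _.
under eq_bigr => j _ do rewrite scalerA.
rewrite -scaler_suml; have /rowP/(_ (enum_rank k)) := vM.
rewrite mxE [in RHS]mxE; under eq_bigr => j _ do rewrite mxE enum_rankK.
by move=> ->; rewrite scale0r.
Qed.

(** A free family of maximal length in [W] spans [W]. *)
Lemma has_dim_sub (I : finType) (y : I -> D) (W : set D) :
  is_subspace W -> W `<=` lin_span (range y) ->
  exists2 d, (d <= #|I|)%N & has_dim W d.
Proof.
move=> subW Wy.
pose P d := `[< exists2 b : 'I_d -> D, free_family b & forall i, W (b i) >].
have Pbound d : P d -> (d <= #|I|)%N.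
  move=> /asboolP[b freeb Wb]; apply: (free_family_bound (y := y) freeb) => i.
  exact/Wy.
have exP : exists d, P d.
  by exists 0%N; apply/asboolP; exists (fun=> 0) => [c _ []|[]].
case: (ex_maxnP exP Pbound) => d Pd maxd; exists d; first exact: Pbound.
have /asboolP[b freeb Wb] := Pd; exists b; split=> //.
rewrite eqEsubset; split; last by apply: lin_span_min => // _ [i _ <-].
move=> w Ww; apply/lin_span_range; apply: contrapT => nspan.
have : P d.+1.
  apply/asboolP; exists (fun i => if unlift ord0 i is Some j then b j else w).
    move=> c; rewrite big_ord_recl unlift_none.
    under eq_bigr => j _ do rewrite liftK.
    have [c0|c0] := eqVneq (c ord0) 0.
      rewrite c0 scale0r add0r => /freeb cl i.
      by case: (unliftP ord0 i) => [j|] ->.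
    move=> cw; case: nspan; exists (fun j => - ((c ord0)^-1 * c (lift ord0 j))).
    rewrite -[LHS](scalerK c0) (canRL (addrK _) cw) sub0r scalerN scaler_sumr.
    by rewrite -sumrN; apply: eq_bigr => j _; rewrite scalerA scaleNr.
  by move=> i; case: unlift.
by move=> /maxd; rewrite ltnn.
Qed.

End FiniteDim.

(** * Elements that almost preserve a finite-dimensional space *)

Section Approx.
Variables (K : fieldType) (D : unitAlgType K) (D_skew : is_skew_field D).

Lemma mxrank_le_ker p q1 q2 (X : 'M[K]_(p, q1)) (Y : 'M[K]_(p, q2)) :
  (forall w : 'rV_p, w *m Y = 0 -> w *m X = 0) -> (\rank X <= \rank Y)%N.
Proof.
move=> kerYX; have /mxrankS : (kermx Y <= kermx X)%MS.
  by apply/rV_subP => w /sub_kermxP/kerYX/sub_kermxP.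
by rewrite !mxrank_ker; have := rank_leq_row X; have := rank_leq_row Y; lia.
Qed.

Section Family.
Variables (s : nat) (x : 'I_s -> D) (freex : free_family x).

Definition lcomb (v : 'rV[K]_s) : D := \sum_j v 0 j *: x j.

Lemma lcombB u v : lcomb (u - v) = lcomb u - lcomb v.
Proof.
by rewrite -sumrB; apply: eq_bigr => j _; rewrite !mxE scalerBl.
Qed.

Lemma lcombD u v : lcomb (u + v) = lcomb u + lcomb v.
Proof.
by rewrite -big_split; apply: eq_bigr => j _; rewrite !mxE scalerDl.
Qed.

Lemma lcombM p (w : 'rV_p) (B : 'M[K]_(p, s)) :
  lcomb (w *m B) = \sum_k w 0 k *: lcomb (row k B).
Proof.
under [RHS]eq_bigr => k _ do rewrite scaler_sumr.
rewrite exchange_big; apply: eq_bigr => j _; rewrite mxE scaler_suml.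
by apply: eq_bigr => k _; rewrite !mxE scalerA.
Qed.

Lemma lcombZ c v : lcomb (c *: v) = c *: lcomb v.
Proof.
by rewrite scaler_sumr; apply: eq_bigr => j _; rewrite !mxE scalerA.
Qed.

Lemma lcomb_eq0 v : lcomb v = 0 -> v = 0.
Proof. exact: free_row_eq0. Qed.

(** Left multiplication by [a] maps a subspace of codimension at most [e] of the
    span of [x] back into this span; the subspace and its image are recorded by
    the coordinates [X] and [Y] of corresponding generators. *)
Definition almost_stable (e : nat) (a : D) : Prop :=
  exists X Y : 'M[K]_s, (s <= \rank X + e)%N /\
    forall w : 'rV_s, a * lcomb (w *m X) = lcomb (w *m Y).

Lemma almost_stable_scalar c : almost_stable 0 c%:A.
Proof.
exists 1%:M, c%:M; split=> [|w]; first by rewrite mxrank1 addn0.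
by rewrite mulmx1 mul_mx_scalar lcombZ -scalerAl mul1r.
Qed.

Lemma almost_stable_leq e e' a :
  (e <= e')%N -> almost_stable e a -> almost_stable e' a.
Proof. by move=> le_ee' [X [Y [rkX XY]]]; exists X, Y; split=> //; lia. Qed.

(** On the intersection of the two preserved parts both products stay in the
    span, and its codimension is at most the sum of theirs. *)
Lemma almost_stableB e e' a b :
  almost_stable e a -> almost_stable e' b -> almost_stable (e + e') (a - b).
Proof.
move=> [X [Y [rkX XY]]] [X' [Y' [rkX' XY']]].
have /submxP[A defA] : (X :&: X' <= X)%MS by apply: capmxSl.
have /submxP[A' defA'] : (X :&: X' <= X')%MS by apply: capmxSr.
exists (X :&: X')%MS, (A *m Y - A' *m Y'); split=> [|w].
  have := mxrank_sum_cap X X'; have := rank_leq_col (X + X')%MS; lia.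
rewrite mulrBl {1}defA defA' mulmxBr lcombB !mulmxA XY; congr (_ - _).
by rewrite -XY'.
Qed.

(** A nonzero [a] is invertible, so corresponding generators of the preserved
    part and of its image satisfy the same relations. *)
Lemma almost_stable_rank e a X Y : a != 0 ->
  (forall w : 'rV_s, a * lcomb (w *m X) = lcomb (w *m Y)) ->
  (s <= \rank X + e)%N -> (s <= \rank Y + e)%N.
Proof.
move=> a0 XY rkX; apply: leq_trans rkX _; rewrite leq_add2r.
apply: mxrank_le_ker => w wY; apply: lcomb_eq0.
have : a * lcomb (w *m X) = 0.
  by rewrite XY wY /lcomb big1 // => j _; rewrite mxE scale0r.
by move=> aw; rewrite -[LHS](mulKr (D_skew a0)) aw mulr0.
Qed.

(** The inverse carries the image of the preserved part back: [X] and [Y] are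
    exchanged. *)
Lemma almost_stableV e a : almost_stable e a -> almost_stable e a^-1.
Proof.
have [->|a0] := eqVneq a 0; first by rewrite invr0.
move=> [X [Y [rkX XY]]]; exists Y, X; split=> [|w].
  exact: almost_stable_rank a0 XY rkX.
by rewrite -XY mulKr ?D_skew.
Qed.

(** The composite is defined where the image under [b] of the part preserved by
    [b] meets the part preserved by [a]. *)
Lemma almost_stableM e e' a b :
  almost_stable e a -> almost_stable e' b -> almost_stable (e + e') (a * b).
Proof.
have [->|b0] := eqVneq b 0.
  move=> _ _; apply: almost_stable_leq (leq0n _) _.
  by rewrite mulr0 -(scale0r (1 : D)); apply: almost_stable_scalar.
move=> [X' [Y' [rkX' XY']]] [X [Y [rkX XY]]].
have /submxP[A defA] : (Y :&: X' <= Y)%MS by apply: capmxSl.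
have /submxP[A' defA'] : (Y :&: X' <= X')%MS by apply: capmxSr.
exists (A *m X), (A' *m Y'); split=> [|w].
  have : (\rank (A *m Y) <= \rank (A *m X))%N.
    apply: mxrank_le_ker => w; rewrite !mulmxA => wAX; apply: lcomb_eq0.
    by rewrite -XY wAX /lcomb big1 ?mulr0 // => j _; rewrite mxE scale0r.
  rewrite -defA; have := almost_stable_rank b0 XY rkX.
  have := mxrank_sum_cap Y X'; have := rank_leq_col (Y + X')%MS; lia.
by rewrite -mulrA !mulmxA XY -mulmxA -defA defA' mulmxA XY'.
Qed.

End Family.
End Approx.

(** * Division subrings generated by a representation of a free group *)

Section Generated.
Variables (K : fieldType) (r : nat) (D : unitAlgType K).
Variable theta : free_group r -> D.
Hypotheses (theta_hom : is_unit_hom theta) (theta_gen : is_generating theta).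

Lemma divring_closedDM (S : {pred D}) : GRing.divring_closed S ->
  (forall x y, x \in S -> y \in S -> x + y \in S) /\
  (forall x y, x \in S -> y \in S -> x * y \in S).
Proof.
move=> [S1 SB SV].
have S0 : 0 \in S by rewrite -(subrr 1) SB.
have SN x : x \in S -> - x \in S by rewrite -sub0r; apply: SB.
have SI x : x \in S -> x^-1 \in S by rewrite -div1r; apply: SV.
split=> x y xS yS; first by rewrite -[y]opprK SB ?SN.
by rewrite -[y]invrK SV ?SI.
Qed.

Lemma hom_in_divring (S : {pred D}) : GRing.divring_closed S ->
  (forall i, theta (fg_gen i) \in S) -> forall g, theta g \in S.
Proof.
move=> clS Sgen; have [_ SM] := divring_closedDM clS; have [S1 SB SV] := clS.
have [unit_th th1 thM] := theta_hom.
have Sletter (x : 'I_r * bool) : theta (@FreeGroup r [:: x] isT) \in S.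
  case: x => i [|]; last exact: Sgen.
  set g := FreeGroup _; have : theta (fg_gen i) * theta g = 1.
    rewrite -thM -th1; congr theta; apply/val_inj; rewrite /= /inv_letter /=.
    by rewrite eqxx.
  move=> thg; rewrite -[theta g](mulKr (unit_th (fg_gen i))) thg mulr1 -div1r.
  exact: SV.
case; elim=> [|x w IHw] red_xw.
  have -> : FreeGroup red_xw = 1%g by apply/val_inj.
  by rewrite th1.
have red_w := reduced_behead red_xw.
have -> : FreeGroup red_xw = (@FreeGroup r [:: x] isT * FreeGroup red_w)%g.
  by apply/val_inj; rewrite /= cons_letterE.
by rewrite thM SM.
Qed.

Lemma generating_ind (S : {pred D}) : GRing.divring_closed S ->
  (forall c, c%:A \in S) -> (forall i, theta (fg_gen i) \in S) ->
  forall x, x \in S.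
Proof.
move=> clS Sscal Sgen; apply: theta_gen => // a.
have [SD SM] := divring_closedDM clS.
rewrite /lin_ext; elim/big_ind: _ => // [|g _].
  by have := Sscal 0; rewrite scale0r.
by rewrite -[theta g]mul1r scalerAl SM // hom_in_divring.
Qed.

End Generated.

(** Division ring expressions are coded as trees because trees over a countable
    type are countable: a node [0] is a difference, any other binary node a
    quotient. *)
Fixpoint division_eval (K : choiceType) (I : choiceType) (D : unitRingType)
    (c : K -> D) (x : I -> D) (t : GenTree.tree (K + I)) : D :=
  match t with
  | GenTree.Leaf (inl a) => c a
  | GenTree.Leaf (inr i) => x i
  | GenTree.Node 0 [:: a; b] => division_eval c x a - division_eval c x b
  | GenTree.Node _ [:: a; b] => division_eval c x a / division_eval c x b
  | _ => 1
  end.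

(** Over a finite field the division ring expressions in the generators are
    countable in number, and they exhaust [D]. *)
Lemma generating_countable_dim (K : finFieldType) (r : nat) (D : unitAlgType K)
    (theta : free_group r -> D) :
  is_unit_hom theta -> is_generating theta -> countable_dim D.
Proof.
move=> theta_hom theta_gen.
pose ev := division_eval (fun a : K => a%:A : D) (fun i => theta (fg_gen i)).
exists (fun n => if choice.unpickle n is Some t then ev t else 0).
rewrite -subTset => d _; apply: sub_lin_span.
suff [t <-] : exists t, ev t = d by exists (choice.pickle t) => //; rewrite choice.pickleK.
suff /asboolP : d \in [pred d | `[< exists t, ev t = d >]] by [].
apply: (generating_ind theta_hom theta_gen) => [|c|i].
- split=> [|x y|x y].
  + by apply/asboolP; exists (GenTree.Node 0 [::]).
  + move=> /asboolP[t <-] /asboolP[t' <-]; apply/asboolP.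
    by exists (GenTree.Node 0 [:: t; t']).
  + move=> /asboolP[t <-] /asboolP[t' <-]; apply/asboolP.
    by exists (GenTree.Node 1 [:: t; t']).
- by apply/asboolP; exists (GenTree.Leaf (inl c)).
- by apply/asboolP; exists (GenTree.Leaf (inr i)).
Qed.

(** * Amenability from almost stable generators *)

Section AlmostStableAmenable.
Variables (R : realType) (K : finFieldType) (r : nat) (D : unitAlgType K).
Variables (D_skew : is_skew_field D) (theta : free_group r -> D).
Hypotheses (theta_hom : is_unit_hom theta) (theta_gen : is_generating theta).

(** The elements whose defect of stability is at most linear in that of the
    generators form a division subring, hence all of [D]. *)
Lemma almost_stable_linear (d : D) : exists C : nat,
  forall s (x : 'I_s -> D) e, free_family x ->
    (forall i, almost_stable x e (theta (fg_gen i))) ->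
    almost_stable x (C * e) d.
Proof.
pose P d := `[< exists C : nat, forall s (x : 'I_s -> D) e, free_family x ->
    (forall i, almost_stable x e (theta (fg_gen i))) ->
    almost_stable x (C * e) d >].
suff /asboolP : d \in [pred d | P d] by [].
have Pscal c : c%:A \in [pred d | P d].
  apply/asboolP; exists 0%N => s x e freex stx; rewrite mul0n.
  exact: almost_stable_scalar.
apply: (generating_ind theta_hom theta_gen) => [|//|i]; last first.
  by apply/asboolP; exists 1%N => s x e freex stx; rewrite mul1n; apply: stx.
split=> [|a b|a b].
- by have := Pscal 1; rewrite scale1r.
- move=> /asboolP[C PC] /asboolP[C' PC']; apply/asboolP; exists (C + C')%N.
  move=> s x e freex stx; rewrite mulnDl.
  by apply: almost_stableB; [apply: PC | apply: PC'].
- move=> /asboolP[C PC] /asboolP[C' PC']; apply/asboolP; exists (C + C')%N.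
  move=> s x e freex stx; rewrite mulnDl; apply: almost_stableM => //.
    exact: PC.
  by apply: almost_stableV => //; apply: PC'.
Qed.

(** If each [a i] is almost stable on the span [V] of [x], then the products of
    the span of [a] with [V] lie in the span of [x] and of the products of [a i]
    with a complement, of dimension at most [e i], of the part of [V] that
    [a i] preserves. *)
Lemma prod_span_bound s (x : 'I_s -> D) (I : finType) (a : I -> D) (e : I -> nat) :
  (forall i, almost_stable x (e i) (a i)) ->
  exists2 d, (d <= s + \sum_i e i)%N &
    has_dim (prod_span (lin_span (range a)) (lin_span (range x))) d.
Proof.
move=> /choice[X] /choice[Y XY].
pose J : finType := ('I_s + {i : I & 'I_(\rank (X i)^C%MS)})%type.
pose y (j : J) := match j with
  | inl k => x k
  | inr u => a (tag u) * lcomb x (row (tagged u) (row_base (X (tag u))^C%MS))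
  end.
have cardJ : (#|J| <= s + \sum_i e i)%N.
  rewrite card_sum card_ord leq_add2l card_tagged sumnE big_map big_enum /=.
  apply: leq_sum => i _; rewrite card_ord mxrank_compl.
  by have [rkX _] := XY i; lia.
have [||d led dimd] := @has_dim_sub _ _ J y
    (prod_span (lin_span (range a)) (lin_span (range x))).
- exact: lin_span_subspace.
- apply: lin_span_min => [|_ [_ [_ [/lin_span_range[c ->] /lin_span_range[u0 ->] ->]]]].
    exact: lin_span_subspace.
  pose u := \row_i u0 i.
  have -> : \sum_i u0 i *: x i = lcomb x u.
    by apply: eq_bigr => i _; rewrite mxE.
  rewrite mulr_suml; under eq_bigr => i _ do rewrite -scalerAl.
  apply: subspace_sum => [|i]; first exact: lin_span_subspace.
  have : (u <= X i + row_base (X i)^C)%MS.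
    have /mxrankS := submx1 u; rewrite (adds_eqmx (eqmx_refl _) (eq_row_base _)).
    by rewrite submx_full // addsmx_compl_full.
  move=> /sub_addsmxP[[w1 w2] ->] /=.
  rewrite lcombD mulrDr -[_ * _]scale1r.
  have [_ spanD] := lin_span_subspace (range y); apply: spanD.
    have [_ ->] := XY i; rewrite /lcomb.
    apply: subspace_sum => [|k]; first exact: lin_span_subspace.
    by apply: sub_lin_span; exists (inl k).
  rewrite lcombM mulr_sumr; under eq_bigr => k _ do rewrite -scalerAr.
  apply: subspace_sum => [|k]; first exact: lin_span_subspace.
  by apply: sub_lin_span; exists (inr (existT _ i k)).
by exists d => //; apply: leq_trans led cardJ.
Qed.

Lemma amenable_of_almost_stable :
  (forall delta : R, 0 < delta -> exists s (x : 'I_s -> D) e,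
    [/\ (0 < s)%N, free_family x, e%:R <= delta * s%:R &
        forall i, almost_stable x e (theta (fg_gen i))]) ->
  amenable R D.
Proof.
move=> stab; split; first exact: generating_countable_dim theta_hom theta_gen.
move=> eps E e0 eps0 [a [_ ->]] _.
have /choice[C PC] i := almost_stable_linear (a i).
pose Ct := (\sum_i C i)%N.
have [|s [x [e [s0 freex le_e stx]]]] := stab (eps / Ct.+1%:R).
  by rewrite divr_gt0.
have [d led dimd] := prod_span_bound (fun i => PC i s x e freex stx).
exists (lin_span (range x)), s, d; split=> //; first by exists x.
have : d%:R <= (s + Ct * e)%N%:R :> R.
  by rewrite ler_nat; apply: leq_trans led _; rewrite /Ct big_distrl.
move=> /le_lt_trans; apply; rewrite natrD natrM mulrDl mul1r ltrD2l.
have := ler_wpM2l (ler0n R Ct) le_e; move=> /le_lt_trans; apply.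
have s0' : 0 < s%:R :> R by rewrite ltr0n.
rewrite mulrA ltr_pM2r // mulrA ltr_pdivrMr // mulrC ltr_pM2l //.
by rewrite ltr_nat.
Qed.

End AlmostStableAmenable.

(** * Free models in the skew field *)

Section ModelsInSkewField.
Variables (K : finFieldType) (D : unitAlgType K) (D_skew : is_skew_field D).
Variables (G : groupType) (r : nat) (gen : 'I_r -> G) (f : G -> D).
Variables (s m : nat) (H : 'M[K]_(s, m)) (T : 'I_r -> 'M[K]_(s, m)).

Notation model := (alg_model gen H T f).

Lemma model_comb (y y' : 'I_m -> D) (d : D) :
  model y -> model y' -> model (fun b => y b + y' b * d).
Proof.
move=> mdl mdl' i j.
have combE (M : 'M[K]_(s, m)) : \sum_b M j b *: (y b + y' b * d) =
    \sum_b M j b *: y b + (\sum_b M j b *: y' b) * d.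
  rewrite mulr_suml -big_split; apply: eq_bigr => b _.
  by rewrite scalerDr scalerAl.
by rewrite !combE mulrDr mulrA mdl mdl'.
Qed.

(** Models are closed under right combinations, and [t] ranges over a finite set:
    for all but finitely many [d], the combination [y + y' d] is nonzero at each
    [t] where one of [y] and [y'] is. *)
Lemma generic_model : (forall l : seq D, exists d, d \notin l) ->
  (forall t : 'rV[K]_m, t != 0 -> exists2 y, model y & lcomb y t != 0) ->
  exists2 y, model y & free_family y.
Proof.
move=> infD exy.
suff [y mdl yt] : exists2 y, model y & forall t, t \in
    [seq t <- enum 'rV[K]_m | t != 0] -> lcomb y t != 0.
  exists y => // c cy i; pose t := \row_i c i.
  have ty : lcomb y t = 0 by rewrite -[RHS]cy; apply: eq_bigr => b _; rewrite mxE.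
  have [/rowP/(_ i)|t0] := eqVneq t 0; first by rewrite !mxE.
  by have := yt t; rewrite mem_filter t0 mem_enum ty eqxx => /(_ erefl).
have : all (fun t => t != 0) [seq t <- enum 'rV[K]_m | t != 0].
  exact: filter_all.
elim: [seq t <- _ | _] => [_|t0 vdim IH /= /andP[t0_neq0 /IH[y mdl yt]]].
  exists (fun=> 0) => // i j; rewrite !big1 ?mulr0 // => b _;
  by rewrite scaler0.
have [y' mdl' yt'] := exy _ t0_neq0.
have [d dP] := infD [seq - (lcomb y' t)^-1 * lcomb y t | t <- t0 :: vdim].
exists (fun b => y b + y' b * d) => [|t tP]; first exact: model_comb.
have -> : lcomb (fun b => y b + y' b * d) t = lcomb y t + lcomb y' t * d.
  rewrite /lcomb mulr_suml -big_split; apply: eq_bigr => b _.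
  by rewrite scalerDr scalerAl.
have [yt0|yt0] := eqVneq (lcomb y' t) 0.
  rewrite yt0 mul0r addr0; apply: yt; move: tP; rewrite inE => /orP[/eqP tt0|//].
  by rewrite -tt0 yt0 eqxx in yt'.
apply: contra dP => /eqP sum0; apply/mapP; exists t => //.
rewrite -[LHS](mulKr (D_skew yt0)) mulNr -mulrN; congr (_ * _).
by apply/eqP; rewrite -addr_eq0 addrC sum0.
Qed.

(** Inside the span of [y], the subspace spanned by [H y] has codimension
    [m - s] and [gen i] maps it into the span of [y]; hence [gen i] maps a part of
    it of codimension at most [m - s] back into it. *)
Lemma almost_stable_model (y : 'I_m -> D) : row_free H ->
  free_family y -> model y ->
  let x j := \sum_b H j b *: y b in
  free_family x /\ forall i, almost_stable x (m - s) (f (gen i)).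
Proof.
move=> freeH freey mdl x.
have lcombx v : lcomb x v = lcomb y (v *m H).
  by rewrite lcombM; apply: eq_bigr => j _; congr (_ *: _); apply: eq_bigr => b _;
    rewrite mxE.
split=> [c cx j|i].
  have : lcomb x (\row_i c i) = 0.
    by rewrite -[RHS]cx; apply: eq_bigr => b _; rewrite mxE.
  rewrite lcombx => /(lcomb_eq0 freey)/eqP; rewrite mulmx_free_eq0 //.
  by move=> /eqP/rowP/(_ j); rewrite !mxE.
have [X rkX XTH] : exists2 X : 'M[K]_s,
    (s <= \rank X + (m - s))%N & X *m (T i *m cokermx H) = 0.
  exists (kermx (T i *m cokermx H)); last exact: mulmx_ker.
  have := mxrankM_maxr (T i) (cokermx H).
  by rewrite mxrank_ker mxrank_coker (eqP freeH); move: (\rank _); lia.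
have XT : (X *m T i <= H)%MS by rewrite submxE -mulmxA XTH.
have [Y defY] := submxP XT; exists X, Y; split=> // w.
rewrite [RHS]lcombx -mulmxA -defY mulmxA [in RHS]lcombM [in LHS]/lcomb mulr_sumr.
apply: eq_bigr => j _; rewrite -scalerAr mdl; congr (_ *: _).
by apply: eq_bigr => b _; rewrite mxE.
Qed.

End ModelsInSkewField.

(** * Comparison of ranks along the sequence *)

Section RankLimits.
Variables (R : realType) (K : fieldType) (r : nat) (n : nat -> nat).
Variable theta_ : forall k, free_group r -> 'M[K]_(n k).
Variables (D : unitAlgType K) (theta : free_group r -> D).
Hypotheses (n_gt0 : forall k, (0 < n k)%N) (theta_lim : is_limit R theta_ theta).

(** An inequality between limits of normalized ranks survives, up to [delta], at
    all large [k]. *)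
Lemma rank_increment (N : nat) (A B : 'M[group_algebra K (free_group r)]_N)
    (z delta : R) : (0 < N)%N -> 0 < delta ->
  (skew_rank (map_mx (lin_ext theta) A))%:R + z <=
    (skew_rank (map_mx (lin_ext theta) B))%:R ->
  exists k0, forall k, (k0 <= k)%N ->
    (\rank (repr_mx (theta_ k) A))%:R + (z - delta) * (n k)%:R <=
      (\rank (repr_mx (theta_ k) B))%:R :> R.
Proof.
move=> N0 delta0 leAB.
have ltz : z - delta < (skew_rank (map_mx (lin_ext theta) B))%:R -
    (skew_rank (map_mx (lin_ext theta) A))%:R by lra.
have [k0 _ Pk0] := cvgr_gt _
  (cvgB (@theta_lim N B N0) (@theta_lim N A N0)) _ ltz.
exists k0 => k /Pk0 /=; rewrite /normalized_rank.
have nk : 0 < (n k)%:R :> R by rewrite ltr0n.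
rewrite -mulrBl ltr_pdivlMr // ltrBrDl => /ltW; exact: le_trans.
Qed.

End RankLimits.

(** * From hyperfiniteness to almost stable subspaces *)

Definition jointly_free (K : fieldType) p m n (Y : 'I_p -> 'M[K]_(m, n)) : Prop :=
  forall v : 'I_p -> 'rV[K]_m, \sum_j v j *m Y j = 0 -> forall j, v j = 0.

Section ModelOfSubspace.
Variables (K : fieldType) (G : groupType) (r : nat) (gen : 'I_r -> G).
Variables (n : nat) (f : G -> 'M[K]_n).

(** Coordinates in bases of [V] and [B] turn a subspace [V] that the generators
    map into [B] into a model. *)
Lemma model_of_subspace (V B : {vspace 'cV[K]_n}) :
  (V <= B)%VS -> (forall i, linfun (mulmx (f (gen i))) @: V <= B)%VS ->
  exists (H : 'M[K]_(\dim V, \dim B)) (T : 'I_r -> 'M[K]_(\dim V, \dim B)),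
    row_free H /\ exists Y : 'M[K]_(\dim B, n),
      [/\ repr_model gen H T f Y, forall t : 'rV[K]_(\dim B), (t *m Y)^T \in B &
          forall t : 'rV[K]_(\dim B), t *m Y = 0 -> t = 0].
Proof.
move=> VB fVB; pose bV := vbasis V; pose bB := vbasis B.
pose Y := \matrix_(b < \dim B) (bB`_b)^T.
have mulY (t : 'rV[K]_(\dim B)) : (t *m Y)^T = \sum_b t 0 b *: bB`_b.
  rewrite mulmx_sum_row linear_sum; apply: eq_bigr => b _.
  by rewrite linearZ /= rowK trmxK.
have bVV (j : 'I_(\dim V)) : bV`_j \in V by apply/vbasis_mem/memt_nth.
have fbVB i (j : 'I_(\dim V)) : f (gen i) *m bV`_j \in B.
  by apply: (subvP (fVB i)); rewrite -(lfunE (mulmx (f (gen i)))) memv_img.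
pose H : 'M[K]_(\dim V, \dim B) := \matrix_(j, b) coord bB b bV`_j.
pose T i : 'M[K]_(\dim V, \dim B) :=
  \matrix_(j, b) coord bB b (f (gen i) *m bV`_j).
exists H, T.
have coordY v (t : 'rV[K]_(\dim B)) : v \in B ->
    (forall b, t 0 b = coord bB b v) -> t *m Y = v^T.
  move=> vB tE; apply: trmx_inj; rewrite mulY trmxK [RHS](coord_vbasis vB).
  by apply: eq_bigr => b _; rewrite tE.
have HY j : row j H *m Y = (bV`_j)^T.
  by apply: coordY => [|b]; rewrite ?(subvP VB) // !mxE.
have TY i j : row j (T i) *m Y = (f (gen i) *m bV`_j)^T.
  by apply: coordY => // b; rewrite !mxE.
split; last first.
  exists Y; split=> [i|t|t tY].
  - apply/row_matrixP => j; rewrite [RHS]row_mul TY trmx_mul -HY.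
    by rewrite -!row_mul.
  - by rewrite mulY; apply: rpred_sum => b _; rewrite rpredZ // vbasis_mem // memt_nth.
  have /freeP freeB := basis_free (vbasisP B).
  by apply/rowP => b; rewrite mxE; apply: freeB; rewrite -mulY tY trmx0.
have /freeP freeV := basis_free (vbasisP V).
apply: inj_row_free => v vH; apply/rowP => j; rewrite mxE; apply: freeV.
apply: trmx_inj; rewrite trmx0 linear_sum /=.
have := mul0mx 1 Y; rewrite -vH -mulmxA mulmx_sum_row => vHY.
rewrite -[RHS]vHY; apply: eq_bigr => k _; rewrite linearZ /= row_mul.
by rewrite -HY.
Qed.

End ModelOfSubspace.

Section RareModels.
Variables (R : realType) (K : finFieldType) (r : nat) (n : nat -> nat).
Variable theta_ : forall k, free_group r -> 'M[K]_(n k).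
Variables (D : unitAlgType K) (theta : free_group r -> D).
Hypotheses (n_gt0 : forall k, (0 < n k)%N).
Hypotheses (theta_repr : forall k, is_linear_repr (theta_ k)).
Hypotheses (D_skew : is_skew_field D) (theta_hom : is_unit_hom theta).
Hypotheses (theta_lim : is_limit R theta_ theta).

Let gen := @fg_gen r.

(** If all models in [D] are killed by some [t], then the values of [t] on the
    models in the representations span a space of dimension [o(n k)], so few
    models fit independently. *)
Lemma rare_models s m (H : 'M[K]_(s, m)) (T : 'I_r -> 'M[K]_(s, m)) t (c : R) :
  t != 0 -> (forall y, alg_model gen H T theta y -> lcomb y t = 0) -> 0 < c ->
  exists k0, forall k, (k0 <= k)%N -> forall p (Y : 'I_p -> 'M[K]_(m, n k)),
    (forall j, repr_model gen H T (theta_ k) (Y j)) -> jointly_free Y ->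
    p%:R <= c * (n k)%:R.
Proof.
move=> t0 kert c0; have [_ th1 _] := theta_hom.
have rk_le := model_skew_rank_le D_skew th1 kert.
have [|||k0 Pk0] := @rank_increment R K r n theta_ D theta n_gt0 theta_lim _
  (model_mx gen H T t) (model_mx gen H T 0) 0 c.
- by apply/card_gt0P; exists (inr None).
- by [].
- by rewrite addr0 ler_nat.
exists k0 => k /Pk0 rkk p Y mdlY freeY.
have [_ f1 _] := theta_repr k.
have [U [rkU valU]] := model_values gen H T f1 t.
have : (p <= \rank U)%N.
  pose W := \matrix_j (t *m Y j).
  have /mxrankS : (W <= U)%MS.
    by apply/row_subP => j; rewrite rowK; apply/valU; exists (Y j).
  suff /eqP -> : row_free W by [].
  apply: inj_row_free => w wW; have wt : forall j, w 0 j *: t = 0.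
    apply: freeY; rewrite -[RHS]wW mulmx_sum_row; apply: eq_bigr => j _.
    by rewrite rowK -scalemxAl.
  apply/rowP => j; rewrite mxE; apply/eqP; move/eqP: (wt j).
  by rewrite scaler_eq0 (negPf t0) orbF.
rewrite -(ler_nat R) => /le_trans; apply.
by move: rkk; rewrite rkU natrD sub0r; lra.
Qed.

(** The data of models with at most [M] vectors. It matters that these are finite
    in number: some type must recur. *)
Definition model_type M : finType :=
  {s : 'I_M.+1 & {m : 'I_M.+1 & ('M[K]_(s, m) * {ffun 'I_r -> 'M[K]_(s, m)})%type}}.

Let vdim M (tau : model_type M) : nat := tag tau.
Let bdim M (tau : model_type M) : nat := tag (tagged tau).
Let vcoord M (tau : model_type M) : 'M[K]_(vdim tau, bdim tau) := (tagged (tagged tau)).1.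
Let gcoord M (tau : model_type M) i : 'M[K]_(vdim tau, bdim tau) :=
  (tagged (tagged tau)).2 i.

Lemma directv_eq0 (L : vectType K) t (B : 'I_t -> {vspace L}) (u : 'I_t -> L) :
  directv (\sum_j B j)%VS -> (forall j, u j \in B j) -> \sum_j u j = 0 ->
  forall j, u j = 0.
Proof.
move=> /directv_sum_independent indB uB sum0 j.
by apply: indB => // i _; apply: uB.
Qed.

(** As [h] is injective, the terms of a relation lie in different members of a
    direct sum. *)
Lemma jointly_free_sub n0 m t p (B : 'I_t -> {vspace 'cV[K]_n0}) (h : 'I_p -> 'I_t)
    (Y : 'I_p -> 'M[K]_(m, n0)) :
  directv (\sum_j B j)%VS -> injective h ->
  (forall a (v : 'rV_m), (v *m Y a)^T \in B (h a)) ->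
  (forall a (v : 'rV_m), v *m Y a = 0 -> v = 0) -> jointly_free Y.
Proof.
move=> dB injh YB injY v sum0 a; apply: (injY a).
have us0 : forall j, \sum_(a | h a == j) (v a *m Y a)^T = 0.
  apply: (directv_eq0 dB) => [j|].
    by apply: memv_suml => b /eqP <-.
  apply: trmx_inj; rewrite trmx0 -[RHS]sum0 [in RHS](partition_big h xpredT) //=.
  rewrite linear_sum; apply: eq_bigr => j _; rewrite linear_sum.
  by apply: eq_bigr => b _; rewrite /= trmxK.
have := us0 (h a); rewrite (big_pred1 a) => [va0|b]; last by rewrite /= (inj_eq injh).
by apply: trmx_inj; rewrite trmx0.
Qed.

Lemma hyperfinite_model_type (k : nat) (delta : R) M t
    (V : 'I_t -> {vspace 'cV[K]_(n k)}) :
  (forall j, (\dim (repr_boundary theta_ (V j)) <= M)%N) ->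
  (forall j, (\dim (repr_boundary theta_ (V j)))%:R <
     (1 + delta) * (\dim (V j))%:R :> R) ->
  forall j, exists tau : model_type M,
    [/\ row_free (vcoord tau), (0 < vdim tau)%N,
        (bdim tau - vdim tau)%N%:R <= delta * (vdim tau)%:R &
        exists Y : 'M[K]_(bdim tau, n k),
          [/\ repr_model gen (vcoord tau) (gcoord tau) (theta_ k) Y,
              forall v : 'rV_(bdim tau), (v *m Y)^T \in repr_boundary theta_ (V j) &
              forall v : 'rV_(bdim tau), v *m Y = 0 -> v = 0]].
Proof.
move=> dimM dimV j; set B := repr_boundary theta_ (V j).
have VB : (V j <= B)%VS by rewrite addvSl.
have [||H [T [freeH [Y [mdlY YB injY]]]]] := @model_of_subspace K _ r gen (n k)
    (theta_ k) (V j) B.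
- exact: VB.
- move=> i; apply: subv_trans (addvSr _ _).
  by rewrite (sumv_sup i).
have ltm := dimM j; have lts := leq_trans (dimvS VB) ltm.
exists (existT _ (Ordinal (lts : _ < M.+1)%N)
  (existT _ (Ordinal (ltm : _ < M.+1)%N) (H, [ffun i => T i]))).
have ltd := dimV j; rewrite -/B in ltd.
have s0 : (0 < \dim (V j))%N.
  rewrite lt0n; apply: contraTneq ltd => ->.
  by rewrite mulr0 -leNgt ler0n.
have les : (\dim B - \dim (V j))%N%:R <= delta * (\dim (V j))%:R.
  by rewrite natrB ?dimvS //; lra.
split=> //.
exists Y; split=> // i; rewrite /gcoord /= ffunE; exact: mdlY.
Qed.

(** If no subspace as required existed, every model type would be rare in the
    representations, by [rare_models] and [generic_model]. At an index where this
    holds for all the types at once, the subspaces given by hyperfiniteness would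
    be too few to reach the prescribed total dimension. *)
Lemma stable_of_hyperfinite : (forall l : seq D, exists d, d \notin l) ->
  hyperfinite R theta_ -> forall delta : R, 0 < delta ->
  exists s (x : 'I_s -> D) e,
    [/\ (0 < s)%N, free_family x, e%:R <= delta * s%:R &
        forall i, almost_stable x e (theta (fg_gen i))].
Proof.
move=> infD hyp delta delta0; apply: contrapT => nostable.
pose eps := Num.min delta (1 / 2).
have [epsd eps2] : eps <= delta /\ eps <= 1 / 2 by rewrite !ge_min !lexx orbT.
have eps0 : 0 < eps by rewrite lt_min delta0; lra.
have [Kp Kp0 hypK] := hyp _ eps0.
pose M := Num.truncn (2 * Kp).
(* With each type occurring at most [c * n k] times, subspaces of dimension at
   most [M] have total dimension at most [n k / 4], less than [(1 - eps) * n k]. *)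
pose c : R := (4 * (M.+1%:R * #|model_type M|.+1%:R))^-1.
have c0 : 0 < c by rewrite invr_gt0 !mulr_gt0.
have good_rare (tau : model_type M) : exists k0, forall k, (k0 <= k)%N ->
    forall p (Y : 'I_p -> 'M[K]_(bdim tau, n k)),
    row_free (vcoord tau) -> (0 < vdim tau)%N ->
    (bdim tau - vdim tau)%N%:R <= delta * (vdim tau)%:R ->
    (forall j, repr_model gen (vcoord tau) (gcoord tau) (theta_ k) (Y j)) ->
    jointly_free Y -> p%:R <= c * (n k)%:R.
  have [[freeH s0 les]|bad] := pselect [/\ row_free (vcoord tau), (0 < vdim tau)%N &
      (bdim tau - vdim tau)%N%:R <= delta * (vdim tau)%:R]; last first.
    by exists 0%N => k _ p Y fH s0 les; case: bad.
  have [[t t0 kert]|nokill] := pselect (exists2 t : 'rV[K]_(bdim tau), t != 0 &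
      forall y, alg_model gen (vcoord tau) (gcoord tau) theta y -> lcomb y t = 0).
    have [k0 Pk0] := rare_models t0 kert c0.
    by exists k0 => k /Pk0 Pk p Y _ _ _; apply: Pk.
  case: nostable.
  have [t t0|y mdl freey] := generic_model D_skew (gen := gen) (f := theta)
      (H := vcoord tau) (T := gcoord tau) infD.
    apply: contrapT => noy; apply: nokill; exists t => // y mdl; apply/eqP.
    by apply: contrapT => /negP ty; apply: noy; exists y.
  have [freex stx] := almost_stable_model freeH freey mdl.
  by do 3 eexists; split; [exact: s0 | exact: freex | exact: les | exact: stx].
have /choice[k0 Pk0] := good_rare.
pose k := (\max_tau k0 tau)%N.
have [t [V [dimV indV bdV sumV]]] := hypK k.
have nk0 : 0 < (n k)%:R :> R by rewrite ltr0n.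
have dimB j : (\dim (repr_boundary theta_ (V j)) <= M)%N.
  rewrite -ltnS -(ltr_nat R); apply: lt_le_trans (bdV j) _.
  apply: le_trans (_ : 2 * Kp <= _); last first.
    by apply/ltW; have /andP[] := truncn_itv (mulr_ge0 (ler0n R 2) (ltW Kp0)).
  apply: ler_pM => //; rewrite ?ler0n //; lra.
have bdV' j : (\dim (repr_boundary theta_ (V j)))%:R <
    (1 + delta) * (\dim (V j))%:R :> R.
  by apply: lt_le_trans (bdV j) _; rewrite ler_wpM2r // lerD2l.
have /choice[tau Ptau] := hyperfinite_model_type dimB bdV'.
have count_tau sigma : (#|[pred j | tau j == sigma]|)%:R <= c * (n k)%:R.
  pose h (a : 'I_#|[pred j | tau j == sigma]|) := enum_val a.
  have tauh a : tau (h a) = sigma by have := enum_valP a; rewrite inE => /eqP.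
  have [->|] := posnP #|[pred j | tau j == sigma]|.
    by rewrite mulr_ge0 // ltW.
  move=> /card_gt0P[j]; rewrite inE => /eqP tauj.
  have := Ptau j; rewrite tauj => -[freeH s0 les _].
  have /choice[Y PY] (a : 'I_#|[pred j | tau j == sigma]|) :
      exists Y : 'M[K]_(bdim sigma, n k),
          [/\ repr_model gen (vcoord sigma) (gcoord sigma) (theta_ k) Y,
              forall v : 'rV_(bdim sigma), (v *m Y)^T \in repr_boundary theta_ (V (h a)) &
              forall v : 'rV_(bdim sigma), v *m Y = 0 -> v = 0].
    by have := Ptau (h a); rewrite tauh => -[].
  apply: (Pk0 sigma k _ _ Y) => // [|a|].
  - exact: leq_bigmax.
  - by have [] := PY a.
  - apply: (jointly_free_sub (h := h) indV) => [|a|a]; first exact: enum_val_inj.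
      by have [] := PY a.
    by have [] := PY a.
have tE : (t = \sum_sigma #|[pred j | tau j == sigma]|)%N.
  rewrite -[LHS]card_ord -sum1_card (partition_big tau xpredT) //=.
  by apply: eq_bigr => sigma _; rewrite sum1_card.
have let_t : t%:R <= #|model_type M|%:R * (c * (n k)%:R).
  rewrite tE natr_sum.
  apply: le_trans (_ : \sum_(sigma : model_type M) c * (n k)%:R <= _).
    by apply: ler_sum.
  by rewrite sumr_const mulr_natl lexx.
have leV : \sum_(j < t) (\dim (V j))%:R <= t%:R * M%:R :> R.
  apply: le_trans (_ : \sum_(j < t) M%:R <= _).
    apply: ler_sum => j _; rewrite ler_nat; apply: leq_trans (dimB j).
    by rewrite dimvS // addvSl.
  by rewrite sumr_const card_ord mulr_natl.
have : (1 - eps) * (n k)%:R <= 1 / 4 * (n k)%:R.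
  apply: (le_trans sumV); apply: (le_trans leV).
  apply: le_trans (ler_wpM2r (ler0n R M) let_t) _.
  have -> : #|model_type M|%:R * (c * (n k)%:R) * M%:R =
      #|model_type M|%:R * M%:R * c * (n k)%:R by ring.
  rewrite ler_wpM2r ?ler0n // /c ler_pdivrMr ?mulr_gt0 //.
  have -> (z : R) : 1 / 4 * (4 * z) = z by field.
  rewrite [leRHS]mulrC.
  by apply: ler_pM; rewrite ?ler0n // ler_nat.
rewrite ler_pM2r //; lra.
Qed.

End RareModels.

(** * Packing independent models *)

Section Packing.
Variables (K : finFieldType) (m n : nat).

Section Counting.
Variable M : {set 'M[K]_(m, n)}.
Hypotheses (M0 : 0 \in M).
Hypothesis MB : forall Y Y', Y \in M -> Y' \in M -> Y - Y' \in M.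

Let fiber (t : 'rV[K]_m) (u : 'rV[K]_n) := [set Y in M | t *m Y == u]%SET.

Let card_fiber_le t u : (#|fiber t u| <= #|fiber t 0%R|)%N.
Proof.
have [->|[Y0]] := set_0Vmem (fiber t u); first by rewrite cards0.
rewrite inE => /andP[Y0M /eqP tY0].
rewrite -(card_imset _ (addIr (- Y0))); apply/subset_leq_card/fintype.subsetP.
move=> _ /imsetP[Y YM ->]; move: YM; rewrite !inE => /andP[YM /eqP tY].
by rewrite MB //= mulmxBr tY tY0 subrr.
Qed.

Let card_fiber_ge t Y0 : Y0 \in M -> (#|fiber t 0%R| <= #|fiber t (t *m Y0)%R|)%N.
Proof.
move=> Y0M; have MN : - Y0 \in M by rewrite -sub0r MB.
rewrite -(card_imset _ (addIr Y0)); apply/subset_leq_card/fintype.subsetP.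
move=> _ /imsetP[Y YM ->]; move: YM; rewrite !inE => /andP[YM /eqP tY].
by rewrite -{1}[Y0]opprK MB //= mulmxDr tY add0r.
Qed.

Let card_values t (P : pred 'rV[K]_n) :
  (#|[set Y in M | P (t *m Y)]%SET| = \sum_(u | P u) #|fiber t u|)%N.
Proof.
rewrite -sum1_card (partition_big (mulmx t) P) => [|Y]; last first.
  by rewrite !inE => /andP[].
apply: eq_bigr => u Pu; rewrite -sum1_card; apply: eq_bigl => Y.
rewrite !inE; case: eqP => [->|_]; by rewrite ?Pu ?andbT ?andbF.
Qed.

(** Over each of its values on [M], the map [Y |-> t *m Y] has as many preimages
    as over [0]; so the preimages of [W] and of [U] compare as [W] and [U]. *)
Lemma card_values_sub w p (t : 'rV[K]_m) (W : 'M[K]_(w, n)) (U : 'M[K]_(p, n)) :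
  (forall u : 'rV[K]_n, (u <= U)%MS -> exists2 Y, Y \in M & t *m Y = u) ->
  (\rank W + m <= \rank U)%N ->
  (#|[set Y in M | (t *m Y <= W)%MS]%SET| * #|K| ^ m <= #|M|)%N.
Proof.
move=> valU rkWU.
have q0 : (0 < #|K|)%N by apply/card_gt0P; exists 0.
have leW : (#|[set Y in M | (t *m Y <= W)%MS]%SET| <=
    #|K| ^ \rank W * #|fiber t 0%R|)%N.
  rewrite (card_values t (fun u : 'rV[K]_n => (u <= W)%MS)) -card_rowg.
  rewrite -sum_nat_const (eq_bigl (fun u : 'rV[K]_n => u \in rowg W)) => [|u].
    by apply: leq_sum => u _; apply: card_fiber_le.
  by rewrite mem_rowg.
have geM : (#|K| ^ \rank U * #|fiber t 0%R| <= #|M|)%N.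
  apply: leq_trans (_ : #|[set Y in M | (t *m Y <= U)%MS]%SET| <= _)%N; last first.
    by apply/subset_leq_card/fintype.subsetP => Y; rewrite inE => /andP[].
  rewrite (card_values t (fun u : 'rV[K]_n => (u <= U)%MS)) -card_rowg -sum_nat_const.
  rewrite [leqRHS](eq_bigl (fun u : 'rV[K]_n => u \in rowg U)) => [|u]; last by rewrite mem_rowg.
  apply: leq_sum => u; rewrite mem_rowg => /valU[Y YM <-].
  exact: card_fiber_ge.
apply: leq_trans geM; apply: leq_trans (leq_mul leW (leqnn _)) _.
by rewrite mulnAC -expnD leq_mul2r leq_pexp2l ?orbT.
Qed.

(** A vector space over a field with [q] elements is not a union of [q ^ m - 1]
    subspaces of codimension at least [m]. *)
Lemma avoid_subspace w (W : 'M[K]_(w, n)) :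
  (forall t : 'rV_m, t != 0 -> exists p (U : 'M[K]_(p, n)),
    (forall u : 'rV[K]_n, (u <= U)%MS -> exists2 Y, Y \in M & t *m Y = u) /\
    (\rank W + m <= \rank U)%N) ->
  exists2 Y, Y \in M & forall t : 'rV_m, (t *m Y <= W)%MS -> t = 0.
Proof.
move=> bigU; apply: contrapT => noY.
pose bad (t : 'rV[K]_m) := [set Y in M | (t *m Y <= W)%MS]%SET.
have MU : M \subset (\bigcup_(t | t != 0) bad t)%SET.
  apply/fintype.subsetP => Y YM; apply: contrapT => /negP Ybad; apply: noY.
  exists Y => // t tY; apply/eqP; apply: contraNT Ybad => t0.
  by apply/finset.bigcupP; exists t => //; rewrite inE YM.
have leM : (#|M| <= \sum_(t | t != 0%R) #|bad t|)%N.
  apply: leq_trans (subset_leq_card MU) _.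
  elim/big_rec2: _ => [|t B1 B2 _ le12]; first by rewrite cards0.
  by rewrite cardsU; apply: leq_trans (leq_subr _ _) _; rewrite leq_add2l.
have M_gt0 : (0 < #|M|)%N by apply/card_gt0P; exists 0.
have q0 : (0 < #|K|)%N by apply/card_gt0P; exists 0.
have := leq_mul leM (leqnn (#|K| ^ m)%N); rewrite big_distrl /=.
have : (\sum_(t : 'rV[K]_m | t != 0%R) #|bad t| * #|K| ^ m <=
    \sum_(t : 'rV[K]_m | t != 0%R) #|M|)%N.
  by apply: leq_sum => t /bigU[p [U [valU rkU]]]; apply: card_values_sub valU rkU.
rewrite sum_nat_const => le1 le2; have := leq_trans le2 le1.
rewrite mulnC leq_pmul2r // leqNgt => /negP[].
have <- : #|'rV[K]_m| = (#|K| ^ m)%N by rewrite card_mx mul1n.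
apply: (@leq_ltn_trans #|predC1 (0 : 'rV[K]_m)|).
  by apply: eq_leq; apply: eq_card => t; rewrite !inE.
by rewrite cardC1 prednK //; apply/card_gt0P; exists 0.
Qed.

End Counting.

(** Greedy packing: as long as there is room, a further model avoids the span
    of those already chosen. *)
Lemma packing (M : {set 'M[K]_(m, n)}) d :
  0 \in M -> (forall Y Y', Y \in M -> Y' \in M -> Y - Y' \in M) ->
  (forall t : 'rV_m, t != 0 -> exists p (U : 'M[K]_(p, n)),
    (forall u : 'rV[K]_n, (u <= U)%MS -> exists2 Y, Y \in M & t *m Y = u) /\
    (d <= \rank U)%N) ->
  forall p, (p * m <= d)%N ->
  exists2 Y : 'I_p -> 'M[K]_(m, n), (forall j, Y j \in M) & jointly_free Y.
Proof.
move=> M0 MB bigU; elim=> [_|p IHp led].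
  by exists (fun=> 0) => // v _ [].
have [|Y YM freeY] := IHp; first by apply: leq_trans led; rewrite leq_mul2r leqnSn orbT.
have [|Y0 Y0M avoid] := @avoid_subspace M M0 MB _ (\mxcol_(j < p) Y j).
  move=> t /bigU[q [U [valU leU]]]; exists q, U; split=> //.
  apply: leq_trans leU; apply: leq_trans led; rewrite mulSn addnC leq_add2l.
  by apply: leq_trans (rank_leq_row _) _; rewrite sum_nat_const card_ord.
exists (fun j => if unlift ord0 j is Some i then Y i else Y0) => [j|v].
  by case: unlift.
rewrite big_ord_recl unlift_none => sum0.
have sumE : \sum_(i < p) v (lift ord0 i) *m
    (if unlift ord0 (lift ord0 i) is Some i then Y i else Y0) =
    \sum_(i < p) v (lift ord0 i) *m Y i.
  by apply: eq_bigr => i _; rewrite liftK.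
move: sum0; rewrite {}sumE => sum0.
have v0 : v ord0 = 0.
  apply: avoid; rewrite (canRL (addrK _) sum0) sub0r -mul_mxrow_mxcol.
  by rewrite eqmx_opp submxMl.
move: sum0; rewrite v0 mul0mx add0r => /freeY vl j.
by case: (unliftP ord0 j) => [i|] ->.
Qed.

End Packing.

(** * Hyperfiniteness from amenability *)

Section HyperfiniteOfAmenable.
Variables (R : realType) (K : finFieldType) (r : nat) (n : nat -> nat).
Variable theta_ : forall k, free_group r -> 'M[K]_(n k).
Variables (D : unitAlgType K) (theta : free_group r -> D).
Hypotheses (n_gt0 : forall k, (0 < n k)%N).
Hypotheses (theta_repr : forall k, is_linear_repr (theta_ k)).
Hypotheses (D_skew : is_skew_field D) (theta_hom : is_unit_hom theta).
Hypotheses (theta_lim : is_limit R theta_ theta).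

Let gen := @fg_gen r.

Definition rowspan N p (A : 'M[K]_(p, N)) : {vspace 'cV[K]_N} :=
  limg (linfun (trmx \o mulmxr A : 'rV_p -> 'cV_N)).

Lemma mem_rowspan N p (A : 'M[K]_(p, N)) u :
  u \in rowspan A <-> exists v, u = (v *m A)^T.
Proof.
split=> [/memv_imgP[v _ ->]|[v ->]]; first by exists v; rewrite lfunE.
by rewrite -[(v *m A)^T](lfunE (trmx \o mulmxr A)) memv_img ?memvf.
Qed.

Lemma dim_rowspan_le N p (A : 'M[K]_(p, N)) : (\dim (rowspan A) <= p)%N.
Proof.
have dimp : \dim {: 'rV[K]_p} = p by rewrite dimvf dim_matrix mul1r.
by rewrite -[leqRHS]dimp -(limg_ker_dim (linfun (trmx \o mulmxr A))) leq_addl.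
Qed.

Lemma dim_rowspan N p (A : 'M[K]_(p, N)) :
  (forall v : 'rV_p, v *m A = 0 -> v = 0) -> \dim (rowspan A) = p.
Proof.
move=> freeA; rewrite limg_dim_eq ?dimvf ?dim_matrix ?mul1r //.
apply/eqP; rewrite -subv0; apply/subvP => v; rewrite memv_cap memv_ker lfunE /=.
move=> /andP[_ /eqP vA]; rewrite memv0; apply/eqP/freeA/trmx_inj.
by rewrite vA trmx0.
Qed.

(** The whole spaces serve as long as their dimension is bounded. *)
Lemma hyperfinite_full k (eps : R) : 0 < eps ->
  exists (t : nat) (V : 'I_t -> {vspace 'cV[K]_(n k)}),
    [/\ forall j, (\dim (V j) <= n k)%N,
        independent_subspaces (fun j => repr_boundary theta_ (V j)),
        forall j, (\dim (repr_boundary theta_ (V j)))%:R <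
                    (1 + eps) * (\dim (V j))%:R :> R
      & (1 - eps) * (n k)%:R <= \sum_(j < t) (\dim (V j))%:R :> R].
Proof.
move=> eps0; exists 1%N, (fun=> fullv).
have dimf : \dim {: 'cV[K]_(n k)} = n k by rewrite dimvf dim_matrix mulr1.
have nk0 : 0 < (n k)%:R :> R by rewrite ltr0n.
split=> [j||j|].
- by rewrite dimf.
- apply/directv_sum_independent => u _; rewrite big_ord1 => u0 j _.
  by rewrite ord1.
- apply: le_lt_trans (_ : (n k)%:R < _).
    by rewrite ler_nat; apply: leq_trans (dimvS (subvf _)) _; rewrite dimf.
  by rewrite dimf; nra.
- by rewrite big_ord1 dimf; nra.
Qed.

(** The boundary of the span of the rows of [H *m Y j] stays in the span of the
    rows of [Y j], and these larger spans are independent. *)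
Lemma hyperfinite_packing k s m (H : 'M[K]_(s, m)) (T : 'I_r -> 'M[K]_(s, m))
    p (Y : 'I_p -> 'M[K]_(m, n k)) (eps : R) : row_free H ->
  (forall j, repr_model gen H T (theta_ k) (Y j)) -> jointly_free Y ->
  m%:R < (1 + eps) * s%:R ->
  exists V : 'I_p -> {vspace 'cV[K]_(n k)},
    [/\ forall j, \dim (V j) = s,
        independent_subspaces (fun j => repr_boundary theta_ (V j))
      & forall j, (\dim (repr_boundary theta_ (V j)))%:R <
                    (1 + eps) * (\dim (V j))%:R].
Proof.
move=> freeH mdlY freeY ltm.
have injY j (v : 'rV_m) : v *m Y j = 0 -> v = 0.
  move=> vY; have := freeY (fun i => if i == j then v else 0).
  rewrite (bigD1 j) //= eqxx vY add0r big1 => [|i /negPf->]; last by rewrite mul0mx.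
  by move=> /(_ erefl j); rewrite eqxx.
exists (fun j => rowspan (H *m Y j)).
have dimV j : \dim (rowspan (H *m Y j)) = s.
  apply: dim_rowspan => v; rewrite mulmxA => /injY/eqP.
  by rewrite mulmx_free_eq0 // => /eqP.
have bdY j : (repr_boundary theta_ (rowspan (H *m Y j)) <= rowspan (Y j))%VS.
  rewrite subv_add; apply/andP; split.
    apply/subvP => _ /mem_rowspan[v ->]; apply/mem_rowspan; exists (v *m H).
    by rewrite mulmxA.
  apply/subv_sumP => i _; apply/subvP => _ /memv_imgP[_ /mem_rowspan[v ->] ->].
  rewrite lfunE /=; apply/mem_rowspan; exists (v *m T i).
  by apply: trmx_inj; rewrite trmx_mul !trmxK -!mulmxA -mdlY !mulmxA.
split=> [//||j].
  apply/directv_sum_independent => u uV sum0.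
  have /choice[v vE] j : exists v, u j = (v *m Y j)^T.
    by apply/mem_rowspan/(subvP (bdY j))/uV.
  move=> j _; rewrite vE (freeY v) ?mul0mx ?trmx0 //.
  apply: trmx_inj; rewrite trmx0 -[RHS]sum0 linear_sum.
  by apply: eq_bigr => i _; rewrite vE.
rewrite dimV; apply: le_lt_trans ltm; rewrite ler_nat.
by apply: leq_trans (dimvS (bdY j)) (dim_rowspan_le _).
Qed.

(** A subspace of [D] that the generators almost preserve gives a model that is
    free in [D]. *)
Lemma free_model_of_amenable (delta : R) : 0 < delta -> amenable R D ->
  exists s m (H : 'M[K]_(s, m)) (T : 'I_r -> 'M[K]_(s, m)) (y : 'I_m -> D),
    [/\ row_free H, m%:R < (1 + delta) * s%:R, alg_model gen H T theta y &
        free_family y].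
Proof.
move=> delta0 [_ amen].
pose a (o : option 'I_r) : D := if o is Some i then theta (gen i) else 1.
have [e _ dimE] := has_dim_sub (lin_span_subspace (range a)) (fun x => id).
have E1 : lin_span (range a) 1 by apply: sub_lin_span; exists None.
have [V [s [m [[b [freeb defV]] [y [freey defEV]] lts]]]] := amen delta _ e delta0 dimE E1.
have bV j : V (b j) by rewrite defV; apply: sub_lin_span; exists j.
have bEV o j : exists c : 'I_m -> K, a o * b j = \sum_i c i *: y i.
  apply/lin_span_range; rewrite -defEV; apply: sub_lin_span.
  by exists (a o), (b j); split=> //; apply: sub_lin_span; exists o.
have [C CE] := choice (fun oj : option 'I_r * 'I_s => bEV oj.1 oj.2).
pose H := \matrix_(j, i) C (None, j) i.
pose T l := \matrix_(j, i) C (Some l, j) i.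
have HE j : \sum_i H j i *: y i = b j.
  rewrite -[RHS]mul1r (CE (None, j)); by apply: eq_bigr => i _; rewrite mxE.
exists s, m, H, T, y; split=> // [|l j]; last first.
  by rewrite HE (CE (Some l, j)); apply: eq_bigr => i _; rewrite mxE.
apply: inj_row_free => v vH; apply: (free_row_eq0 freeb).
under eq_bigr => j _ do rewrite -HE.
have := lcombM y v H; rewrite vH /lcomb big1 => [vE|i _]; last by rewrite mxE scale0r.
rewrite [RHS]vE; apply: eq_bigr => j _; congr (_ *: _); apply: eq_bigr => i _.
by congr (_ *: _); rewrite [RHS]mxE.
Qed.

(** The packing stops when fewer than [m] dimensions are left out of
    [(1 - delta) * n k]. As [m <= delta * n k] for the representations that are
    not treated by [hyperfinite_full], the rows of the models cover
    [(1 - 2 * delta) * n k] dimensions and the subspaces at least the fraction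
    [1 / (1 + delta)] of these, at least [(1 - 3 * delta) * n k]. *)
Lemma hyperfinite_of_amenable : amenable R D -> hyperfinite R theta_.
Proof.
move=> amen eps eps0; have [_ th1 _] := theta_hom.
pose delta := Num.min eps 1 / 3.
have delta0 : 0 < delta by rewrite divr_gt0 // lt_min eps0 ltr01.
have [deps d3] : 3 * delta <= eps /\ 3 * delta <= 1.
  by rewrite /delta mulrC divfK // !ge_min !lexx orbT.
have [s [m [H [T [y [freeH ltm mdly freey]]]]]] := free_model_of_amenable delta0 amen.
have rk_t (t : 'rV[K]_m) : exists k0, forall k, (k0 <= k)%N -> t != 0 ->
    (\rank (repr_mx (theta_ k) (model_mx gen H T 0)))%:R + (1 - delta) * (n k)%:R <=
    (\rank (repr_mx (theta_ k) (model_mx gen H T t)))%:R :> R.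
  have [->|t0] := eqVneq t 0; first by exists 0%N.
  have [|||k0 Pk0] := @rank_increment R K r n theta_ D theta n_gt0 theta_lim _
    (model_mx gen H T 0) (model_mx gen H T t) 1 delta.
  - by apply/card_gt0P; exists (inr None).
  - by [].
  - rewrite natr1 ler_nat; apply: model_skew_rank_gt => //; exists y => //.
    by apply: contra t0 => /eqP/(free_row_eq0 freey)->.
  by exists k0 => k /Pk0.
have /choice[k0 Pk0] := rk_t.
pose k1 := (\max_t k0 t)%N.
(* The terms bound the subspaces of the packing, the spaces too small for the
   packing, and the finitely many spaces before the rank estimates hold. *)
pose Kp : R := m%:R + m%:R / delta + (\sum_(k < k1) n k)%N%:R + 1.
have md0 : 0 <= m%:R / delta by rewrite divr_ge0 // ltW.
exists Kp => [|k]; first by rewrite /Kp ltr_wpDl // !addr_ge0.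
have nk0 : 0 < (n k)%:R :> R by rewrite ltr0n.
have small : (n k)%:R <= Kp -> exists (t : nat) (V : 'I_t -> {vspace 'cV[K]_(n k)}),
    [/\ forall j, (\dim (V j))%:R <= Kp,
        independent_subspaces (fun j => repr_boundary theta_ (V j)),
        forall j, (\dim (repr_boundary theta_ (V j)))%:R <
                    (1 + eps) * (\dim (V j))%:R
      & (1 - eps) * (n k)%:R <= \sum_(j < t) (\dim (V j))%:R].
  move=> lenK; have [t [V [dimV indV bdV sumV]]] := hyperfinite_full k eps0.
  exists t, V; split=> // j; apply: le_trans lenK; by rewrite ler_nat.
have [ltk|lek] := ltnP k k1.
  apply: small; apply: le_trans (_ : (\sum_(k < k1) n k)%N%:R <= _).
    by rewrite ler_nat (bigD1 (Ordinal ltk)) //= leq_addr.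
  by rewrite /Kp; have := ler0n R m; lra.
have [len|ltn] := leP (n k)%:R (m%:R / delta).
  by apply: small; rewrite /Kp; have := ler0n R m; have := ler0n R (\sum_(k < k1) n k)%N; lra.
have lemn : m%:R <= delta * (n k)%:R.
  by move: ltn; rewrite ltr_pdivrMr // mulrC => /ltW.
pose d := Num.truncn ((1 - delta) * (n k)%:R).
have d1 : 0 <= (1 - delta) * (n k)%:R by rewrite mulr_ge0 // ?ltW //; lra.
have /andP[led ltd] := truncn_itv d1; rewrite -/d in led ltd.
have [_ f1 _] := theta_repr k.
pose M := [set Y | `[< repr_model gen H T (theta_ k) Y >]]%SET.
have MP Y : Y \in M <-> repr_model gen H T (theta_ k) Y.
  by rewrite finset.inE; split=> [/asboolP|?] //; apply/asboolP.
have [||t t0|Y YM freeY] := @packing K m (n k) M d _ _ _ (d %/ m)%N (leq_trunc_div _ _).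
- by apply/MP => i; rewrite mulmx0 mul0mx mulmx0.
- move=> Y Y' /MP mdlY /MP mdlY'; apply/MP => i.
  by rewrite !(mulmxBr, mulmxBl) mdlY mdlY'.
- have [U [rkU valU]] := model_values gen H T f1 t; exists _, U; split.
    by move=> u /valU[Y mdlY tY]; exists Y => //; apply/MP.
  have lek0 : (k0 t <= k)%N by apply: leq_trans lek; apply: leq_bigmax.
  have := Pk0 t k lek0 t0; rewrite rkU natrD lerD2l => /(le_trans led).
  by rewrite ler_nat.
have mdlY j : repr_model gen H T (theta_ k) (Y j) by apply/MP.
have [V [dimV indV bdV]] := hyperfinite_packing freeH mdlY freeY ltm.
exists (d %/ m)%N, V; split=> // [j|j|].
- rewrite dimV; apply: le_trans (_ : m%:R <= _).
    by rewrite ler_nat -(eqP freeH) rank_leq_col.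
  by rewrite /Kp; have := ler0n R (\sum_(k < k1) n k)%N; lra.
- apply: lt_le_trans (bdV j) _; rewrite ler_wpM2r // lerD2l.
  by apply: le_trans deps; lra.
have lesm : (s <= m)%N by rewrite -(eqP freeH) rank_leq_col.
have m0 : (0 < m)%N.
  rewrite lt0n; apply: contraTneq ltm => m0; rewrite m0 leqn0 in lesm.
  by rewrite m0 (eqP lesm) mulr0 ltxx.
under eq_bigr => j _ do rewrite dimV.
rewrite sumr_const card_ord -(mulr_natl s%:R).
have : (d < (d %/ m) * m + m)%N by rewrite {1}(divn_eq d m) ltn_add2l ltn_mod.
move: (d %/ m)%N => p; rewrite -ltnS => ltp.
have {}ltp : d.+1%:R <= p%:R * m%:R + m%:R :> R.
  by rewrite -natrM -natrD ler_nat.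
have pm : p%:R * m%:R <= (1 + delta) * (p%:R * s%:R) :> R.
  by rewrite mulrCA ler_wpM2l // ltW.
have ltn2 : (1 - 2 * delta) * (n k)%:R <= (1 + delta) * (p%:R * s%:R).
  by apply: le_trans pm; move: ltd; rewrite -natr1 in ltp *; lra.
have len3 : (1 + delta) * ((1 - 3 * delta) * (n k)%:R) <=
    (1 - 2 * delta) * (n k)%:R.
  have le3 : (1 + delta) * (1 - 3 * delta) <= 1 - 2 * delta by nra.
  by have := ler_wpM2r (ltW nk0) le3; rewrite -mulrA.
apply: le_trans (_ : (1 - 3 * delta) * (n k)%:R <= _).
  by rewrite ler_wpM2r // lerD2l lerN2.
by rewrite -(ler_pM2l (_ : 0 < 1 + delta)); [apply: le_trans len3 _ | lra].
Qed.

End HyperfiniteOfAmenable.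

(** * The equivalence *)

(** A finite [D] is finite-dimensional over [K] and preserved by all its
    elements. *)
Lemma stable_of_finite (K : fieldType) (D : unitAlgType K) (l : seq D) :
  (forall d, d \in l) -> exists s (x : 'I_s -> D),
    [/\ (0 < s)%N, free_family x & forall a, almost_stable x 0 a].
Proof.
move=> finD; pose y (i : 'I_(size l)) := l`_i.
have subT : is_subspace (setT : set D) by [].
have [|s _ [x [freex /esym spanx]]] := has_dim_sub (y := y) subT.
  move=> d _; apply: sub_lin_span.
  by exists (Ordinal (etrans (index_mem d l) (finD d))) => //; apply: nth_index.
have inx d : exists c : 'I_s -> K, d = \sum_i c i *: x i.
  by apply/lin_span_range; rewrite spanx.
exists s, x; split=> // [|a].
  rewrite lt0n; apply/eqP => s0; have [c /eqP] := inx 1.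
  by rewrite big1 ?oner_eq0 // => i; have := ltn_ord i; rewrite {2}s0.
have /choice[C CE] j := inx (a * x j).
exists 1%:M, (\matrix_(j, i) C j i); split=> [|w]; first by rewrite mxrank1 addn0.
rewrite mulmx1 lcombM mulr_sumr; apply: eq_bigr => j _.
rewrite -scalerAr CE; congr (_ *: _); apply: eq_bigr => i _.
by rewrite !mxE.
Qed.

Theorem theorem3 (R : realType) (K : finFieldType) (r : nat) (n : nat -> nat)
    (theta_ : forall k : nat, free_group r -> 'M[K]_(n k))
    (D : unitAlgType K) (theta : free_group r -> D)
    (n_gt0 : forall k, (0 < n k)%N)
    (theta_repr : forall k, is_linear_repr (theta_ k))
    (theta_cvg : convergent R theta_)
    (theta_Atiyah : Atiyah_condition R theta_)
    (D_skew : is_skew_field D)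
    (theta_hom : is_unit_hom theta)
    (theta_lim : is_limit R theta_ theta)
    (theta_gen : is_generating theta) :
  hyperfinite R theta_ <-> amenable R D.
Proof.
split=> [hyp|]; last first.
  exact: (hyperfinite_of_amenable n_gt0 theta_repr D_skew theta_hom theta_lim).
apply: (amenable_of_almost_stable D_skew theta_hom theta_gen) => delta delta0.
have [infD|/existsNP[l finD]] := pselect (forall l : seq D, exists d, d \notin l).
  exact: (stable_of_hyperfinite n_gt0 theta_repr D_skew theta_hom theta_lim).
have [|s [x [s0 freex stx]]] := @stable_of_finite K D l.
  by move=> d; apply: contrapT => /negP dl; apply: finD; exists d.
by exists s, x, 0%N; split=> //; rewrite mulr_ge0 // ltW.
Qed.
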